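(* Let $n,k$ be positive integers with $k\geqslant n$, and let $F(x_1,\ldots,x_n)\in\mathbb{Q}[x_1,\ldots,x_n]$ be a symmetric polynomial of degree $r$. Then $$\sum_{\substack{k_1+\cdots+k_n=k\\ k_j\geqslant 1}}F(k_1,\ldots,k_n)\zeta(2k_1,\ldots,2k_n)=\sum_{l=0}^{\min\{T,k\}}c_{F,l}(k)\zeta(2l)\zeta(2k-2l)$$ and $$\sum_{\substack{k_1+\cdots+k_n=k\\ k_j\geqslant 1}}F(k_1,\ldots,k_n)\zeta^{\star}(2k_1,\ldots,2k_n)=\sum_{l=0}^{\min\{T,k\}}c^{\star}_{F,l}(k)\zeta(2l)\zeta(2k-2l),$$ where $T=\max\{[(r+n-2)/2],[(n-1)/2]\}$ and $c_{F,l}(x),c^{\star}_{F,l}(x)\in\mathbb{Q}[x]$ depend only on $l$ and $F$ (not on $k$), with $\deg c_{F,l}(x),\deg c^{\star}_{F,l}(x)\leqslant r+n-2l-1$.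
   Context: For positive integers $k_1,\ldots,k_n$ with $k_1>1$, the multiple zeta value is $\zeta(k_1,\ldots,k_n)=\sum_{m_1>\cdots>m_n\geqslant1}\frac{1}{m_1^{k_1}\cdots m_n^{k_n}}$ and the multiple zeta-star value is $\zeta^{\star}(k_1,\ldots,k_n)=\sum_{m_1\geqslant\cdots\geqslant m_n\geqslant1}\frac{1}{m_1^{k_1}\cdots m_n^{k_n}}$. In depth one these are the Riemann zeta values; $\zeta(0)=-\frac12$. $[x]$ is the greatest integer not exceeding $x$. *)

(* Defs.v *)
From mathcomp Require Import all_boot all_order all_algebra.
From mathcomp Require Import classical_sets boolp reals ereal esum.

Set Implicit Arguments.
Unset Strict Implicit.
Unset Printing Implicit Defensive.

Import Order.TTheory GRing.Theory Num.Theory.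
Local Open Scope classical_set_scope.
Local Open Scope ring_scope.

Section MultipleZeta.
Variables (R : realType) (n : nat).
Implicit Type s : 'I_n -> nat.

Definition mzv_dom : set {ffun 'I_n -> nat} :=
  [set m | (forall i j : 'I_n, (i < j)%N -> (m j < m i)%N) /\
           (forall i : 'I_n, (1 <= m i)%N)].

Definition mzsv_dom : set {ffun 'I_n -> nat} :=
  [set m | (forall i j : 'I_n, (i < j)%N -> (m j <= m i)%N) /\
           (forall i : 'I_n, (1 <= m i)%N)].

Definition mz_term s (m : {ffun 'I_n -> nat}) : R :=
  (\prod_(i < n) (m i)%:R ^+ s i)^-1.

(* The terms are nonnegative, so the sum over the index set is the supremum of
   the finite partial sums.  It is finite when every exponent is positive and
   the first one is > 1; [fine] returns 0 for a divergent series. *)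
Definition mzv s : R := fine (\esum_(m in mzv_dom) (mz_term s m)%:E).

Definition mzsv s : R := fine (\esum_(m in mzsv_dom) (mz_term s m)%:E).

End MultipleZeta.

Definition zeta (R : realType) (s : nat) : R :=
  if s == 0%N then - 2^-1 else mzv R (fun _ : 'I_1 => s).

Definition is_composition (n k : nat) (a : {ffun 'I_n -> 'I_k.+1}) : bool :=
  [forall j, (1 <= a j)%N] && ((\sum_(j < n) a j)%N == k).

(* For n = 1, r = 0 the truncated subtraction gives 0 instead of [-1/2] = -1 in
   the first argument, which does not change the maximum. *)
Definition bound_T (n r : nat) : nat :=
  maxn ((r + n - 2) %/ 2) ((n - 1) %/ 2).

(* Main.v *)
Require Import Defs.
From HB Require Import structures.
From mathcomp Require Import all_boot all_order all_algebra perm finmap.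
From mathcomp Require Import boolp classical_sets cardinality fsbigop.
From mathcomp Require Import reals ereal esum topology normedtype sequences.
From mathcomp Require Import ring lra zify.
From mathcomp Require Import(canonicals, coercions) mpoly.

(** Put [delta = u d/du] and [W(u) = sum_(k >= 0) zeta(2k) u^k].  Euler's
convolution [sum_(0<i<k) zeta(2i) zeta(2k-2i) = (k + 1/2) zeta(2k)] is the
Riccati equation [delta W = W^2 + W/2 + t] with [t = tau u],
[tau = (3/2) zeta(2)].  Since
[F] is symmetric, the sum over ordered tuples [m] can be symmetrised to a sum
over all tuples with an integer weight, and merging equal entries turns the
generating function of the left hand side into a polynomial in the series
[sum_(k >= 1) g(k) zeta(2k) u^k] ([g] a polynomial), hence into a polynomial in
[W] and [t], of weight at most [r + n] when [W], [t] have weights 1, 2.  The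
Riccati equation, read as [W^(i+1) = delta(W^i)/i - W^i/2 - t W^(i-1)],
rewrites it as a rational combination of [t^l] and [t^l delta^j W] with
[2l + j + 1 <= r + n]; the coefficient of [u^k] of the latter is
[tau^l (k-l)^j zeta(2k-2l)], and [tau^l] is a rational multiple of [zeta(2l)].
The pair [W = s, t = - s^2], with [delta = (s/2) d/ds], also satisfies the
Riccati equation, and there the generating function becomes a polynomial of
degree at most [n] in [s]: this kills the pure powers [t^l] that would
contribute for [k >= n], and the terms with [l > T]. *)

Set Implicit Arguments.
Unset Strict Implicit.
Unset Printing Implicit Defensive.

Import Order.TTheory GRing.Theory Num.Theory numFieldNormedType.Exports.
Local Open Scope ring_scope.

(** * Normal forms for the Riccati equation *)

Section Riccati.
Variables (B : comNzRingType) (q : {rmorphism rat -> B}) (D : B -> B) (t W : B).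
Hypothesis DD : forall x y, D (x + y) = D x + D y.
Hypothesis DM : forall x y, D (x * y) = D x * y + x * D y.
Hypothesis Dq : forall a, D (q a) = 0.
Hypothesis Dt : D t = t.
Hypothesis DW : D W = W ^+ 2 + q 2^-1 * W + t.

Inductive wt : nat -> B -> Prop :=
| wt0 w : wt w 0
| wtD w x y : wt w x -> wt w y -> wt w (x + y)
| wt_mon w a l i : (2 * l + i <= w)%N -> wt w (q a * (t ^+ l * W ^+ i)).

(** The inequality in [nf_iter] is strict because [iter j D W] itself has weight [j + 1]. *)
Inductive nf : nat -> B -> Prop :=
| nf0 w : nf w 0
| nfD w x y : nf w x -> nf w y -> nf w (x + y)
| nf_const w a l : (2 * l <= w)%N -> nf w (q a * t ^+ l)
| nf_iter w a l j : (2 * l + j < w)%N -> nf w (q a * (t ^+ l * iter j D W)).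

Lemma der0 : D 0 = 0.
Proof. by have := Dq 0; rewrite rmorph0. Qed.

Lemma derX x n : D (x ^+ n) = q n%:R * (x ^+ n.-1 * D x).
Proof.
elim: n => [|[|n] IH].
- by have := Dq 1; rewrite rmorph1 expr0 rmorph0 mul0r.
- by rewrite expr1 rmorph1 expr0 !mul1r.
rewrite exprS DM IH /= -[n.+2]addn1 natrD rmorphD rmorph1 exprS; ring.
Qed.

Lemma der_tX l : D (t ^+ l) = q l%:R * t ^+ l.
Proof. by rewrite derX Dt; case: l => [|l]; rewrite ?rmorph0 ?mul0r // -exprSr. Qed.

Lemma wt_le w v x : (w <= v)%N -> wt w x -> wt v x.
Proof.
move=> wv H; elim: H wv => {w x} [w|w x y _ Hx _ Hy|w a l i H] wv.
- exact: wt0.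
- by apply: wtD; [exact: Hx|exact: Hy].
- by apply: wt_mon; lia.
Qed.

Lemma wt_scale w a x : wt w x -> wt w (q a * x).
Proof.
elim=> {w x} [w|w x y _ Hx _ Hy|w b l i H].
- by rewrite mulr0; exact: wt0.
- by rewrite mulrDr; exact: wtD.
- by rewrite mulrA -rmorphM; exact: wt_mon.
Qed.

Lemma wt_const w a : wt w (q a).
Proof. by have := @wt_mon w a 0 0 isT; rewrite !expr0 !mulr1. Qed.

Lemma wt_sum w (I : Type) (s : seq I) (P : pred I) f :
  (forall i, P i -> wt w (f i)) -> wt w (\sum_(i <- s | P i) f i).
Proof. by move=> H; elim/big_rec: _ => [|i x Pi Hx]; [exact: wt0|apply: wtD; auto]. Qed.

Lemma wtM w v x y : wt w x -> wt v y -> wt (w + v) (x * y).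
Proof.
move=> Hx Hy; elim: Hx => {w x} [w|w x x' _ Hx _ Hx'|w a l i H].
- by rewrite mul0r; exact: wt0.
- by rewrite mulrDl; exact: wtD.
elim: Hy => {v y} [v|v y y' _ IHy _ IHy'|v b l' i' H'].
- by rewrite mulr0; exact: wt0.
- by rewrite mulrDr; exact: wtD.
have -> : q a * (t ^+ l * W ^+ i) * (q b * (t ^+ l' * W ^+ i'))
  = q (a * b) * (t ^+ (l + l') * W ^+ (i + i')) by rewrite rmorphM !exprD; ring.
by apply: wt_mon; lia.
Qed.

(** [D] keeps the weight of a power of [t], while the Riccati equation replaces one factor [W] of
    weight 1 by terms of weight at most 2. *)
Lemma wt_deriv w x : wt w x -> wt w.+1 (D x).
Proof.
elim=> {w x} [w|w x y _ Hx _ Hy|w a l i H].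
- by rewrite der0; exact: wt0.
- by rewrite DD; exact: wtD.
case: i H => [|i] H.
  rewrite expr0 mulr1 DM Dq mul0r add0r der_tX; apply: wt_scale.
  by have := @wt_mon w.+1 l%:R l 0; rewrite expr0 mulr1; apply; lia.
have -> : D (q a * (t ^+ l * W ^+ i.+1)) =
   q a * (q l%:R * (t ^+ l * W ^+ i.+1) + (q i.+1%:R * (t ^+ l * W ^+ i.+2)
    + (q (i.+1%:R * 2^-1) * (t ^+ l * W ^+ i.+1) + q i.+1%:R * (t ^+ l.+1 * W ^+ i)))).
  rewrite DM Dq mul0r add0r DM der_tX derX DW /= rmorphM !exprS; ring.
by apply: wt_scale; do ![apply: wtD]; apply: wt_mon; lia.
Qed.

Lemma wt_iter j : wt j.+1 (iter j D W).
Proof.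
elim: j => [|j IH]; last exact: wt_deriv.
by have := @wt_mon 1 1 0 1 isT; rewrite rmorph1 expr0 !mul1r.
Qed.

Lemma nf_le w v x : (w <= v)%N -> nf w x -> nf v x.
Proof.
move=> wv H; elim: H wv => {w x} [w|w x y _ Hx _ Hy|w a l H|w a l j H] wv.
- exact: nf0.
- by apply: nfD; [exact: Hx|exact: Hy].
- by apply: nf_const; lia.
- by apply: nf_iter; lia.
Qed.

Lemma nf_scale w a x : nf w x -> nf w (q a * x).
Proof.
elim=> {w x} [w|w x y _ Hx _ Hy|w b l H|w b l j H].
- by rewrite mulr0; exact: nf0.
- by rewrite mulrDr; exact: nfD.
- by rewrite mulrA -rmorphM; exact: nf_const.
- by rewrite mulrA -rmorphM; exact: nf_iter.
Qed.

Lemma nf_mult l w x : nf w x -> nf (2 * l + w) (t ^+ l * x).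
Proof.
elim=> {w x} [w|w x y _ Hx _ Hy|w b k H|w b k j H].
- by rewrite mulr0; exact: nf0.
- by rewrite mulrDr; exact: nfD.
- by rewrite mulrCA -exprD; apply: nf_const; lia.
- by rewrite mulrCA [t ^+ l * _]mulrA -exprD; apply: nf_iter; lia.
Qed.

Lemma nf_deriv w x : nf w x -> nf w.+1 (D x).
Proof.
elim=> {w x} [w|w x y _ Hx _ Hy|w a l H|w a l j H].
- by rewrite der0; exact: nf0.
- by rewrite DD; exact: nfD.
- rewrite DM Dq mul0r add0r der_tX; apply: nf_scale; apply: nf_const; lia.
- rewrite DM Dq mul0r add0r DM der_tX -mulrA mulrDr; apply: nfD; apply: nf_scale.
    by apply: nf_iter; lia.
  rewrite -[_ * D _]mul1r -(rmorph1 q); apply: (@nf_iter _ _ _ j.+1); lia.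
Qed.

(** Strong induction: solved for its top power, the Riccati equation leaves [W^(i+1)] under one [D]
    or none and [W^i] times one [t], and each of these fits the weight [i + 2]. *)
Lemma nf_XW i : nf i (W ^+ i).
Proof.
elim/ltn_ind: i => -[|[|i]] IH.
- by have := @nf_const 0 1 0 isT; rewrite rmorph1 mul1r.
- by have := @nf_iter 1 1 0 0 isT; rewrite rmorph1 !mul1r.
have -> : W ^+ i.+2 = q (i.+1%:R^-1) * D (W ^+ i.+1) +
   (q (- 2^-1) * W ^+ i.+1 + q (- 1) * (t ^+ 1 * W ^+ i)).
  rewrite derX mulrA -rmorphM mulVf ?rmorph1 ?mul1r; last by rewrite pnatr_eq0.
  rewrite DW !rmorphN rmorph1 /= !exprS; ring.
apply: nfD; last apply: nfD; apply: nf_scale.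
- by apply: nf_deriv; apply: IH.
- by apply: nf_le (IH i.+1 _).
- by apply: nf_le (nf_mult 1 (IH i _)).
Qed.

Lemma wt_nf w x : wt w x -> nf w x.
Proof.
elim=> {w x} [w|w x y _ Hx _ Hy|w a l i H]; [exact: nf0|exact: nfD|].
by apply: nf_scale; apply: nf_le H _; apply: nf_mult; exact: nf_XW.
Qed.

(** The sums run over a full rectangle so that adding two normal forms adds coefficients; the weight
    bound survives as the vanishing of [a] and [b]. *)
Lemma nf_coef w x : nf w x -> exists (a : nat -> nat -> rat) (b : nat -> rat),
  [/\ forall l j, (w <= 2 * l + j)%N -> a l j = 0,
      forall l, (w < 2 * l)%N -> b l = 0 &
      x = \sum_(l < w.+1) \sum_(j < w) q (a l j) * (t ^+ l * iter j D W)
          + \sum_(l < w.+1) q (b l) * t ^+ l].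
Proof.
elim=> {w x} [w|w x y _ [a [b [a0 b0 ->]]] _ [a' [b' [a'0 b'0 ->]]]|w c l H|w c l j H].
- exists (fun _ _ => 0), (fun _ => 0); split=> //.
  rewrite !big1 ?addr0 // => i _; first by rewrite rmorph0 mul0r.
  by rewrite big1 // => j _; rewrite rmorph0 mul0r.
- exists (fun l j => a l j + a' l j), (fun l => b l + b' l); split.
  + by move=> l j H; rewrite a0 ?a'0 ?addr0.
  + by move=> l H; rewrite b0 ?b'0 ?addr0.
  rewrite addrACA; congr (_ + _); rewrite -big_split /=; apply: eq_bigr => l _; last first.
    by rewrite rmorphD mulrDl.
  by rewrite -big_split; apply: eq_bigr => j _; rewrite rmorphD mulrDl.
- exists (fun _ _ => 0), (fun l' => if l' == l then c else 0); split=> //.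
    by move=> l' H'; case: eqP => // ?; lia.
  rewrite big1 ?add0r; last first.
    by move=> i _; rewrite big1 // => j _; rewrite rmorph0 mul0r.
  have lw : (l < w.+1)%N by lia.
  rewrite (bigD1 (Ordinal lw)) //= eqxx big1 ?addr0 // => i.
  by rewrite -val_eqE /= => /negbTE ->; rewrite rmorph0 mul0r.
- exists (fun l' j' => if (l' == l) && (j' == j) then c else 0), (fun _ => 0).
  split=> //.
    by move=> l' j' H'; case: andP => // -[/eqP ? /eqP ?]; lia.
  rewrite [X in _ + X]big1 ?addr0; last by move=> i _; rewrite rmorph0 mul0r.
  have lw : (l < w.+1)%N by lia.
  have jw : (j < w)%N by lia.
  rewrite (bigD1 (Ordinal lw)) //= (bigD1 (Ordinal jw)) //= !eqxx.
  rewrite big1 ?addr0; last first.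
    by move=> i; rewrite -val_eqE /= => /negbTE ->; rewrite rmorph0 mul0r.
  rewrite big1 ?addr0 // => i; rewrite -val_eqE /= => /negbTE ->.
  by rewrite big1 // => k _; rewrite rmorph0 mul0r.
Qed.

End Riccati.

(** * Convolutions of polynomials *)

Section PowerSum.
Variable K : numFieldType.

(** Discrete integration: the forward difference of [X^(d+1)/(d+1)] is [X^d] plus lower terms, so a
    multiple of it removes the top coefficient of [g]. *)
Lemma power_sum_poly (d : nat) (g : {poly K}) : (size g <= d)%N ->
  exists2 S : {poly K}, (size S <= d.+1)%N &
    forall k : nat, S.[k%:R] = \sum_(a < k) g.[a%:R].
Proof.
elim: d g => [|d IH] g.
  rewrite leqn0 size_poly_eq0 => /eqP ->; exists 0; first by rewrite size_poly0.
  by move=> k; rewrite big1 ?horner0 // => i _; rewrite horner0.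
move=> sg.
pose p : {poly K} := (g`_d / d.+1%:R) *: 'X^(d.+1).
have dp : (size (p \Po ('X + 1) - p - g`_d *: 'X^d)%R <= d)%N.
  have -> : p \Po ('X + 1) - p - g`_d *: 'X^d =
     (g`_d / d.+1%:R) *: \sum_(i < d) ('C(d.+1, i))%:R *: 'X^i.
    rewrite /p comp_polyZ comp_Xn_poly exprDn_comm; last exact: commr1.
    under eq_bigr do rewrite expr1n mulr1.
    (* After reversal the summation index is the exponent of [X], and the two top terms of the
       binomial expansion split off. *)
    rewrite (reindex_inj rev_ord_inj) /=.
    under eq_bigr => i _ do rewrite subSS subKn ?leq_ord // bin_sub ?leq_ord //.
    rewrite !big_ord_recr /= binn -scalerBr mulr1n addrK binSn.
    under eq_bigr => i _ do rewrite -scaler_nat.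
    by rewrite -['X^d *+ _]scaler_nat scalerDr scalerA mulfVK ?addrK ?pnatr_eq0.
  apply: leq_trans (size_scale_leq _ _) _.
  apply: leq_trans (size_sum _ _ _) _; apply/bigmax_leqP => i _.
  by apply: leq_trans (size_scale_leq _ _) _; rewrite size_polyXn.
have [|S sS HS] := IH (g - (p \Po ('X + 1) - p)).
  have -> : g - (p \Po ('X + 1) - p) =
    (g - g`_d *: 'X^d) - (p \Po ('X + 1) - p - g`_d *: 'X^d).
    by set c := _ - p; rewrite [- (c - _)]opprB addrA subrK.
  apply: leq_trans (size_polyD _ _) _; rewrite size_polyN geq_max dp andbT.
  apply/leq_sizeP => j; rewrite leq_eqVlt => /predU1P[<-|dj].
    by rewrite coefB coefZ coefXn eqxx mulr1 subrr.
  rewrite coefB coefZ coefXn gtn_eqF // mulr0 subr0.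
  by rewrite nth_default //; apply: leq_trans sg dj.
exists (S + p).
  apply: leq_trans (size_polyD _ _) _; rewrite geq_max; apply/andP; split; first by lia.
  by apply: leq_trans (size_scale_leq _ _) _; rewrite size_polyXn.
move=> k; rewrite hornerD HS.
have -> : p.[k%:R] = \sum_(a < k) (p \Po ('X + 1) - p).[a%:R].
  elim: k => [|k IHk]; first by rewrite big_ord0 /p hornerZ hornerXn expr0n mulr0.
  rewrite big_ord_recr /= -IHk hornerD hornerN horner_comp hornerD hornerX.
  by rewrite hornerC addrCA subrr addr0 natr1.
by rewrite -big_split /=; apply: eq_bigr => a _; rewrite -hornerD subrK.
Qed.

(** The sum runs over [a + b = k + 1] with both parts positive. For [g' = p X + c], writing the
    factor [b] as [(k + 1) - a] leaves convolutions of [g] and of [g X] with [p]; the constant [c]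
    costs one power sum. *)
Lemma conv_poly (g g' : {poly K}) : exists2 S : {poly K},
  (size S <= size g + size g')%N &
  forall k : nat, S.[k.+1%:R] = \sum_(a < k) g.[a.+1%:R] * g'.[(k - a)%:R].
Proof.
elim/poly_ind: g' g => [|p c IH] g.
  exists 0; first by rewrite size_poly0.
  by move=> k; rewrite big1 ?horner0 // => a _; rewrite horner0 mulr0.
have [->|g0] := eqVneq g 0.
  exists 0; first by rewrite size_poly0.
  by move=> k; rewrite big1 ?horner0 // => a _; rewrite horner0 mul0r.
have [S1 sS1 HS1] := IH g.
have [S2 sS2 HS2] := IH (g * 'X).
have [S3 sS3 HS3] := power_sum_poly (leqnn (size g)).
have sg : (0 < size g)%N by rewrite size_poly_gt0.
have key k : ('X * S1 - S2 + c *: (S3 - (g.[0])%:P)).[k.+1%:R] =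
  \sum_(a < k) g.[a.+1%:R] * (p * 'X + c%:P).[(k - a)%:R].
  (* [S3] sums from argument 0, while the convolution starts at 1. *)
  have S3E : S3.[k.+1%:R] - g.[0] = \sum_(a < k) g.[a.+1%:R].
    by rewrite HS3 big_ord_recl addrAC subrr add0r.
  rewrite !(hornerD, hornerN, hornerM, hornerX, hornerZ, hornerC) S3E HS1 HS2.
  rewrite !mulr_sumr -sumrB -big_split /=; apply: eq_bigr => a _.
  rewrite !(hornerD, hornerM, hornerX, hornerC).
  have -> : k.+1%:R = a.+1%:R + (k - a)%:R :> K.
    by rewrite -natrD; congr _%:R; have := ltn_ord a; lia.
  ring.
(* [p X + c] has size [size p + 1] unless both vanish, so the degenerate cases are treated apart to
   keep the size bound. *)
have [p0|p0] := eqVneq p 0.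
  have [c0|c0] := eqVneq c 0.
    exists 0; first by rewrite size_poly0.
    by move=> k; rewrite big1 ?horner0 // => a _; rewrite p0 c0 mul0r add0r hornerC mulr0.
  exists (c *: (S3 - (g.[0])%:P)).
    rewrite p0 mul0r add0r size_polyC c0 addn1.
    apply: leq_trans (size_scale_leq _ _) _.
    apply: leq_trans (size_polyD _ _) _; rewrite size_polyN geq_max sS3.
    by apply: leq_trans (size_polyC_leq1 _) _.
  move=> k; rewrite -key; move: sS1 sS2.
  have HS1' : S1.[k.+1%:R] = 0 by rewrite HS1 big1 // => a _; rewrite p0 horner0 mulr0.
  have HS2' : S2.[k.+1%:R] = 0 by rewrite HS2 big1 // => a _; rewrite p0 horner0 mulr0.
  by rewrite [RHS]hornerD hornerD hornerN hornerM HS1' HS2' mulr0 subr0 add0r.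
exists ('X * S1 - S2 + c *: (S3 - (g.[0])%:P)) => //.
have sp : (0 < size p)%N by rewrite size_poly_gt0.
rewrite size_MXaddC (negbTE p0) /=.
have sgX : size (g * 'X) = (size g).+1 by rewrite size_mulX.
rewrite sgX in sS2.
apply: leq_trans (size_polyD _ _) _; rewrite geq_max; apply/andP; split.
  apply: leq_trans (size_polyD _ _) _; rewrite geq_max size_polyN addnS -addSn sS2 andbT.
  by apply: leq_trans (size_polyMleq _ _) _; rewrite size_polyX /= addSn ltnS.
apply: leq_trans (size_scale_leq _ _) _.
apply: leq_trans (size_polyD _ _) _; rewrite size_polyN geq_max addnS.
rewrite (leq_trans sS3) ?ltnS ?leq_addr //=.
by apply: leq_trans (size_polyC_leq1 _) _.
Qed.

End PowerSum.

(** * The ring of formal power series *)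

Definition pseries (R : Type) := nat -> R.

Section PowerSeries.
Variable R : comNzRingType.
Implicit Types f g h : pseries R.

HB.instance Definition _ := gen_eqMixin (pseries R).
HB.instance Definition _ := gen_choiceMixin (pseries R).

Definition ps_add f g : pseries R := fun k => f k + g k.
Definition ps_opp f : pseries R := fun k => - f k.
Definition ps_zero : pseries R := fun _ => 0.
Definition ps_const (a : R) : pseries R := fun k => if k is 0%N then a else 0.
Definition ps_mul f g : pseries R := fun k => \sum_(i < k.+1) f i * g (k - i)%N.
Definition ps_trunc K f : {poly R} := \poly_(i < K.+1) f i.

(** Low coefficients of a Cauchy product only see truncations, so commutativity and associativity
    are inherited from polynomials. *)
Lemma ps_mul_trunc K f g k : (k <= K)%N ->
  ps_mul f g k = (ps_trunc K f * ps_trunc K g)`_k.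
Proof.
move=> kK; rewrite coefM; apply: eq_bigr => i _; rewrite !coef_poly.
have Hi := ltn_ord i; rewrite !ifT //; lia.
Qed.

Fact ps_addA : associative ps_add.
Proof. by move=> f g h; apply/funext => k; exact: addrA. Qed.
Fact ps_addC : commutative ps_add.
Proof. by move=> f g; apply/funext => k; exact: addrC. Qed.
Fact ps_add0 : left_id ps_zero ps_add.
Proof. by move=> f; apply/funext => k; exact: add0r. Qed.
Fact ps_addN : left_inverse ps_zero ps_opp ps_add.
Proof. by move=> f; apply/funext => k; exact: addNr. Qed.

HB.instance Definition _ :=
  GRing.isZmodule.Build (pseries R) ps_addA ps_addC ps_add0 ps_addN.

Fact ps_mulC : commutative ps_mul.
Proof. by move=> f g; apply/funext => k; rewrite !(ps_mul_trunc _ _ (leqnn k)) mulrC. Qed.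

Fact ps_mulA : associative ps_mul.
Proof.
have E f g h k : ps_mul (ps_mul f g) h k = (ps_trunc k f * ps_trunc k g * ps_trunc k h)`_k.
  rewrite /ps_mul coefM; apply: eq_bigr => i _; have := ltn_ord i => Hi.
  by rewrite -(@ps_mul_trunc k) 1?coef_poly ?ifT //; lia.
move=> f g h; apply/funext => k; rewrite E ps_mulC E.
by congr (nth 0 (polyseq _) k); ring.
Qed.

Fact ps_mul1 : left_id (ps_const 1) ps_mul.
Proof.
move=> f; apply/funext => k; rewrite /ps_mul big_ord_recl /= mul1r subn0.
by rewrite big1 ?addr0 // => i _; rewrite mul0r.
Qed.

Fact ps_mulD : left_distributive ps_mul ps_add.
Proof.
move=> f g h; apply/funext => k; rewrite /ps_mul /ps_add -big_split.
by apply: eq_bigr => i _; exact: mulrDl.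
Qed.

Fact ps_oner_neq0 : ps_const 1 != 0 :> pseries R.
Proof. by apply/eqP => /(congr1 (fun f => f 0%N)) /eqP; apply/negP; exact: oner_neq0. Qed.

HB.instance Definition _ := GRing.Zmodule_isComNzRing.Build (pseries R)
  ps_mulA ps_mulC ps_mul1 ps_mulD ps_oner_neq0.

Lemma ps_addE f g k : (f + g) k = f k + g k. Proof. by []. Qed.
Lemma ps_oppE f k : (- f) k = - f k. Proof. by []. Qed.
Lemma ps_mulE f g k : (f * g) k = \sum_(i < k.+1) f i * g (k - i)%N. Proof. by []. Qed.
Lemma ps_oneE k : (1 : pseries R) k = (k == 0%N)%:R. Proof. by case: k. Qed.

Lemma ps_sumE (I : Type) (s : seq I) (P : pred I) (F : I -> pseries R) k :
  (\sum_(i <- s | P i) F i) k = \sum_(i <- s | P i) F i k.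
Proof. by elim/big_rec2: _ => // i x y _ <-. Qed.

Fact ps_const_is_additive : zmod_morphism ps_const.
Proof. by move=> a b; apply/funext => -[|k]; rewrite ps_addE ps_oppE /= ?subr0. Qed.
Fact ps_const_is_monoid_morphism : monoid_morphism ps_const.
Proof.
split=> // a b; apply/funext => k; rewrite ps_mulE big_ord_recl /= subn0.
by rewrite big1 ?addr0; [case: k => //= ?; rewrite mulr0|move=> i _; rewrite mul0r].
Qed.
HB.instance Definition _ := GRing.isZmodMorphism.Build R (pseries R) ps_const ps_const_is_additive.
HB.instance Definition _ := GRing.isMonoidMorphism.Build R (pseries R) ps_const ps_const_is_monoid_morphism.

Lemma ps_constM a f k : (ps_const a * f) k = a * f k.
Proof.
rewrite ps_mulE big_ord_recl /= subn0.
by rewrite big1 ?addr0 // => i _; rewrite mul0r.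
Qed.

(** The derivation [delta = u d/du], acting on coefficients. *)
Definition ps_euler f : pseries R := fun k => k%:R * f k.

Lemma ps_eulerD f g : ps_euler (f + g) = ps_euler f + ps_euler g.
Proof. by apply/funext => k; rewrite /ps_euler !ps_addE mulrDr. Qed.

Lemma ps_eulerM f g : ps_euler (f * g) = ps_euler f * g + f * ps_euler g.
Proof.
apply/funext => k; rewrite /ps_euler ps_addE !ps_mulE mulr_sumr -big_split /=.
apply: eq_bigr => i _; rewrite -[k in k%:R](@subnKC i) -1?ltnS // natrD.
rewrite mulrDl mulrA; congr (_ + _); ring.
Qed.

Definition ps_mono (c : R) (l : nat) : pseries R := fun k => if k == l then c else 0.

Lemma ps_monoM c l f k :
  (ps_mono c l * f) k = if (l <= k)%N then c * f (k - l)%N else 0.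
Proof.
rewrite ps_mulE; case: leqP => lk.
  have lk' : (l < k.+1)%N by [].
  rewrite (bigD1 (Ordinal lk')) //= {1}/ps_mono eqxx big1 ?addr0 // => i.
  by rewrite -val_eqE /= /ps_mono => /negbTE ->; rewrite mul0r.
by rewrite big1 // => i _; rewrite /ps_mono ltn_eqF ?mul0r //; have := ltn_ord i; lia.
Qed.

Lemma ps_monoX c l : ps_mono c 1 ^+ l = ps_mono (c ^+ l) l.
Proof.
elim: l => [|l IH]; first by apply/funext => -[|k].
rewrite exprS IH; apply/funext => -[|k]; rewrite ps_monoM //=.
by rewrite subn1 /= /ps_mono eqSS exprS; case: eqP; rewrite ?mulr0.
Qed.

End PowerSeries.

(** * Symmetrisation of sums over ordered tuples *)

Section Symmetrization.
Variables (R : comNzRingType) (N : nat) (star : bool).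

Definition ordgeq : rel 'I_N := fun i j => (j <= i)%N.
Definition star_sign : R := if star then 1 else - 1.
Definition mz_sorted (s : seq 'I_N) : bool := sorted ordgeq s && (star || uniq s).

(* The number of permutations that bring the sequence into decreasing order:
   weakly if [star], strictly otherwise. *)
Fixpoint star_weight (s : seq 'I_N) : R :=
  if s is x :: s' then star_weight s' * (1 + star_sign * (count_mem x s')%:R) else 1.

Lemma ordgeq_trans : transitive ordgeq.
Proof. by move=> x y z; rewrite /ordgeq => H1 H2; apply: leq_trans H2 H1. Qed.
Lemma ordgeq_anti : antisymmetric ordgeq.
Proof. by move=> x y /anti_leq /val_inj. Qed.
Lemma ordgeq_total : total ordgeq.
Proof. by move=> x y; exact: leq_total. Qed.

Lemma sum_count_mem (T : finType) (s : seq T) :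
  (\sum_(x in s) count_mem x s = size s)%N.
Proof.
rewrite big_mkcond -[RHS](count_predT s).
rewrite (eq_bigr (fun x => count_mem x s)); last first.
  by move=> x _; case: ifPn => // /count_memPn ->.
elim: s => [|y s IH] /=; first by rewrite big1.
by rewrite big_split /= IH (bigD1 y) //= eqxx big1 // => x /negbTE; rewrite eq_sym => ->.
Qed.

(** Both sides are sums over sorted tuples with one marked value, weighted by its multiplicity.
    Inserting [x] gives it multiplicity [1 + count_mem x t]; without [star] a second copy is
    forbidden, and its weight [1 - 1] vanishes. The multiplicities in one tuple add up to
    [n + 1]. *)
Lemma insertion_sum n (g : n.+1.-tuple 'I_N -> R) :
  (forall s t : n.+1.-tuple 'I_N, perm_eq s t -> g s = g t) ->
  \sum_(t : n.-tuple 'I_N | mz_sorted t) \sum_(x : 'I_N)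
     (1 + star_sign * (count_mem x t)%:R) * g [tuple of x :: t] =
  n.+1%:R * \sum_(t : n.+1.-tuple 'I_N | mz_sorted t) g t.
Proof.
move=> gP.
pose h (p : n.-tuple 'I_N * 'I_N) : n.+1.-tuple 'I_N * 'I_N :=
  ([tuple of sort ordgeq (p.2 :: p.1)], p.2).
(* [h'] undoes the insertion [h]; [nseq n p.2] is a default, taken only when [p.2] does not occur in
   [p.1]. *)
pose h' (p : n.+1.-tuple 'I_N * 'I_N) : n.-tuple 'I_N * 'I_N :=
  (insubd [tuple of nseq n p.2] (rem p.2 p.1), p.2).
have h'E (p : n.+1.-tuple 'I_N * 'I_N) : p.2 \in val p.1 -> rem p.2 p.1 = (h' p).1 :> seq _.
  by move=> xt; rewrite /h' val_insubd ifT // size_rem // size_tuple.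
transitivity (\sum_(p : n.+1.-tuple 'I_N * 'I_N | mz_sorted p.1 && (p.2 \in val p.1))
   (count_mem p.2 p.1)%:R * g p.1); last first.
  rewrite mulr_sumr -(pair_big_dep (fun t : n.+1.-tuple 'I_N => mz_sorted t)
    (fun t x => x \in val t) (fun t x => (count_mem x t)%:R * g t)) /=.
  apply: eq_bigr => t _; rewrite -mulr_suml -natr_sum; congr (_%:R * _).
  by rewrite sum_count_mem size_tuple.
rewrite (reindex_onto h h') /=; last first.
  case=> t x /= /andP[/andP[st _] xt]; congr pair; apply: val_inj => /=.
  apply: (sorted_eq ordgeq_trans ordgeq_anti) => //; first exact: sort_sorted ordgeq_total _.
  by rewrite perm_sort -(h'E (t, x)) // perm_sym perm_to_rem.
rewrite pair_big /= [LHS](bigID (fun p : n.-tuple 'I_N * 'I_N => star || (p.2 \notin val p.1))) /=.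
rewrite [X in _ + X]big1 ?addr0; last first.
  move=> [t x] /= /andP[/andP[/andP[st sut] _]]; rewrite negb_or negbK => /andP[nstar xt].
  move: sut; rewrite /star_sign (negbTE nstar) /= => ut.
  by rewrite (count_uniq_mem _ ut) xt mulr1 subrr mul0r.
apply: eq_big => [[t x]|[t x] /= /andP[/andP[st _] H]] /=.
  rewrite mem_sort mem_head andbT {2}/mz_sorted sort_sorted ?sort_uniq /=; last exact: ordgeq_total.
  have pe : perm_eq (rem x (sort ordgeq (x :: t))) t.
    rewrite -(perm_cons x) perm_sym.
    apply: perm_trans (perm_to_rem _); last by rewrite mem_sort mem_head.
    by rewrite perm_sym perm_sort.
  (* Deleting what was inserted returns [t] sorted, which is [t] exactly when [t] was sorted. *)
  have -> : (h' (h (t, x)) == (t, x)) = sorted ordgeq t.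
    have xin : (h (t, x)).2 \in val (h (t, x)).1 by rewrite mem_sort mem_head.
    rewrite [h' _]surjective_pairing xpair_eqE [(h' _).2 == x]eqxx andbT.
    rewrite -val_eqE [val _](esym (h'E _ xin)) /=.
    apply/eqP/idP => [<-|st]; last first.
      apply: (sorted_eq ordgeq_trans ordgeq_anti) => //.
      apply: subseq_sorted (rem_subseq _ _) _; first exact: ordgeq_trans.
      exact: sort_sorted ordgeq_total _.
    apply: subseq_sorted (rem_subseq _ _) _; first exact: ordgeq_trans.
    exact: sort_sorted ordgeq_total _.
  rewrite /mz_sorted /=; case: (sorted ordgeq t); rewrite ?andbF //= !andbT.
  by case: (star) => //=; rewrite andbC.
congr (_ * _); last by apply: gP; rewrite /= perm_sym perm_sort.
rewrite count_sort /= eqxx natrD; congr (_ + _).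
move: H st; rewrite /star_sign /mz_sorted; case: (star) => /= [_ _|xt _]; first by rewrite mul1r.
by rewrite (count_memPn xt) mulr0.
Qed.

Lemma sum_tuple_cons (V : nmodType) n (f : n.+1.-tuple 'I_N -> V) :
  \sum_(t : n.+1.-tuple 'I_N) f t =
  \sum_(x : 'I_N) \sum_(t : n.-tuple 'I_N) f [tuple of x :: t].
Proof.
rewrite pair_big /=.
rewrite (reindex (fun p : 'I_N * n.-tuple 'I_N => [tuple of p.1 :: p.2])) //=.
exists (fun t => (thead t, [tuple of behead t])) => [[x t] _|t _] /=.
  by congr pair; apply: val_inj.
by rewrite -tuple_eta.
Qed.

(** Induction on the length: the head contributes its factor of [star_weight], the induction
    hypothesis sorts the tail at the price of [n!], and [insertion_sum] inserts the head for the
    remaining [n + 1]. *)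
Lemma symmetrize_sum n (g : n.-tuple 'I_N -> R) :
  (forall s t : n.-tuple 'I_N, perm_eq s t -> g s = g t) ->
  \sum_(t : n.-tuple 'I_N) star_weight t * g t =
  n`!%:R * \sum_(t : n.-tuple 'I_N | mz_sorted t) g t.
Proof.
elim: n g => [|n IH] g gP.
  rewrite mul1r; apply: eq_big => t; rewrite (tuple0 t) ?mul1r //.
  by rewrite /mz_sorted orbT.
rewrite sum_tuple_cons.
transitivity (\sum_(x : 'I_N) \sum_(t : n.-tuple 'I_N | mz_sorted t)
   n`!%:R * ((1 + star_sign * (count_mem x t)%:R) * g [tuple of x :: t])).
  apply: eq_bigr => x _; rewrite -mulr_sumr -IH.
    by apply: eq_bigr => t _ /=; rewrite mulrA.
  move=> s t st; congr (_ * _); first by rewrite (seq.permP st).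
  by apply: gP; rewrite /= perm_cons.
rewrite exchange_big /= factS mulnC natrM -mulrA -insertion_sum // mulr_sumr.
by apply: eq_bigr => t _; rewrite mulr_sumr.
Qed.

End Symmetrization.

(** * Euler's convolution for truncated zeta values *)

Section TruncatedZeta.
Variable R : realFieldType.

Definition harm (n : nat) : R := \sum_(i < n) (i.+1%:R)^-1.

Definition ztrunc (N k : nat) : R := \sum_(m < N) (m.+1%:R ^+ (2 * k))^-1.

Lemma harmS n : harm n.+1 = harm n + (n.+1%:R)^-1.
Proof. by rewrite /harm big_ord_recr. Qed.

Let sqdiff (m n : nat) : R := (n.+1%:R ^+ 2 - m.+1%:R ^+ 2)^-1.

Lemma sqdiff_split m n : n != m ->
  2 * m.+1%:R * sqdiff m n = (n.+1%:R - m.+1%:R)^-1 - (n.+1%:R + m.+1%:R)^-1.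
Proof.
move=> nm; rewrite /sqdiff.
have h1 : n.+1%:R - m.+1%:R != 0 :> R by rewrite subr_eq0 eqr_nat eqSS.
have h2 : n.+1%:R + m.+1%:R != 0 :> R by rewrite -natrD pnatr_eq0.
move: h1 h2; set a := n.+1%:R; set b := m.+1%:R; move: a b => a b h1 h2.
by rewrite subr_sqr; field; rewrite h1 h2.
Qed.

(** Here every [n - m] is negative, so the reciprocals run down to [harm (m - N)]; the case [N = m]
    starts the induction of [sum_sqdiff]. *)
Lemma sum_sqdiff_lt m N : (N <= m)%N ->
  \sum_(n < N) 2 * m.+1%:R * sqdiff m n =
  harm (m - N) - harm m + harm m.+1 - harm (N + m.+1).
Proof.
elim: N => [|N IH] Nm; first by rewrite big_ord0 subn0 add0n; ring.
rewrite big_ord_recr /= IH ?(ltnW Nm) // sqdiff_split; last by lia.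
rewrite addSn (harmS (N + _)) -(subnSK Nm) (harmS (m - _)).
have -> : N.+1%:R - m.+1%:R = - (m - N.+1).+1%:R :> R.
  by rewrite subnSK // natrB ?(ltnW Nm) // -!natr1; ring.
by rewrite invrN -natrD addSn; ring.
Qed.

(** Partial fractions telescope into harmonic numbers. The bracket tends to 0 with [N], which gives
    (with [m], [n] counted from 1) the classical value [3/(4 m^2)] for the sum of [1/(n^2 - m^2)]
    over [n] different from [m]. *)
Lemma sum_sqdiff m N : (m < N)%N ->
  \sum_(n < N | n != m :> nat) 2 * m.+1%:R * sqdiff m n =
  3 / 2 / m.+1%:R - (harm (N + m.+1) - harm (N - m.+1)).
Proof.
elim: N => // N IH; rewrite ltnS leq_eqVlt => /predU1P[<-|mN]; last first.
  rewrite big_mkcond big_ord_recr /= -big_mkcond /= IH // gtn_eqF //= sqdiff_split; last by lia.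
  rewrite addSn (harmS (N + _)) subSS -(subnSK mN) (harmS (N - _)).
  have -> : N.+1%:R - m.+1%:R = (N - m.+1).+1%:R :> R.
    by rewrite subnSK // natrB ?(ltnW mN) // -!natr1; ring.
  by rewrite -natrD addSn; ring.
rewrite big_mkcond big_ord_recr /= eqxx addr0.
rewrite (eq_bigr (fun n : 'I_m => 2 * m.+1%:R * sqdiff m n)); last first.
  by move=> n _; rewrite ltn_eqF.
rewrite sum_sqdiff_lt // !subnn addSn !harmS /harm big_ord0.
have -> : (m + m.+1).+1%:R = 2 * m.+1%:R :> R by rewrite -natrM; congr _%:R; lia.
have : m.+1%:R != 0 :> R by rewrite pnatr_eq0.
by move: (m.+1%:R) => a h; field.
Qed.

Lemma harm_diff n d : 0 <= harm (n + d) - harm n <= d%:R / n.+1%:R.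
Proof.
elim: d => [|d /andP[h1 h2]]; first by rewrite addn0 subrr mul0r lexx.
rewrite addnS harmS -[d.+1%:R]natr1 mulrDl mul1r addrAC; apply/andP; split.
  by rewrite addr_ge0 // invr_ge0.
by rewrite lerD // lef_pV2 ?posrE ?ltr0n // ler_nat; lia.
Qed.

(** The defect of the truncated sum of [sqdiff] from its limit. *)
Let sqdiff_tail (N m : nat) : R := (harm (N + m.+1) - harm (N - m.+1)) / (2 * m.+1%:R).

Lemma sum_sqdiffE m N : (m < N)%N ->
  \sum_(n < N | n != m :> nat) sqdiff m n = 3 / 4 * (m.+1%:R ^+ 2)^-1 - sqdiff_tail N m.
Proof.
move=> mN; have h : m.+1%:R != 0 :> R by rewrite pnatr_eq0.
apply: (@mulfI _ (2 * m.+1%:R)); first by rewrite mulf_neq0 // pnatr_eq0.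
rewrite mulr_sumr sum_sqdiff // /sqdiff_tail; move: (harm _ - harm _) => d.
by move: (m.+1%:R) h => a h; field.
Qed.

(** The difference of harmonic numbers has [2(m+1)] terms, each at most [1/(N-m)]. *)
Lemma sqdiff_tail_bound m N : (m < N)%N -> 0 <= sqdiff_tail N m <= ((N - m)%:R)^-1.
Proof.
move=> mN; have := harm_diff (N - m.+1) (m.+1 + m.+1).
have -> : (N - m.+1 + (m.+1 + m.+1) = N + m.+1)%N by lia.
rewrite subnSK // natrD -mulr2n -[_ *+ 2]mulr_natl => /andP[h1 h2].
have h : 0 < 2 * m.+1%:R :> R by rewrite mulr_gt0 ?ltr0n.
rewrite /sqdiff_tail divr_ge0 ?(ltW h) //= ler_pdivrMr //.
by rewrite [X in _ <= X]mulrC.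
Qed.

Lemma ztruncX N k : ztrunc N k = \sum_(m < N) ((m.+1%:R ^+ 2)^-1) ^+ k.
Proof. by apply: eq_bigr => m _; rewrite exprM exprVn. Qed.

(** A geometric sum, together with [A A' / (A - A') = 1 / (1/A' - 1/A)]. *)
Lemma sqinv_sum_ne (m n k : nat) : n != m ->
  let A := (m.+1%:R ^+ 2)^-1 : R in let A' := (n.+1%:R ^+ 2)^-1 : R in
  \sum_(i < k.+1) A ^+ i.+1 * A' ^+ (k.+1 - i) =
  (A ^+ k.+1 - A' ^+ k.+1) * sqdiff m n.
Proof.
move=> nm A A'.
have h1 : m.+1%:R != 0 :> R by rewrite pnatr_eq0.
have h2 : n.+1%:R != 0 :> R by rewrite pnatr_eq0.
have h3 : n.+1%:R ^+ 2 - m.+1%:R ^+ 2 != 0 :> R.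
  by rewrite subr_eq0 eqrXn2 // eqr_nat eqSS.
have -> : \sum_(i < k.+1) A ^+ i.+1 * A' ^+ (k.+1 - i) =
   A * A' * \sum_(i < k.+1) A ^+ (k.+1.-1 - i) * A' ^+ i.
  rewrite [in RHS](reindex_inj rev_ord_inj) mulr_sumr; apply: eq_bigr => i _ /=.
  rewrite subSS subKn -1?ltnS // [in LHS]subSn -1?ltnS // !exprS; ring.
rewrite subrXX [RHS]mulrAC /sqdiff; congr (_ * _).
rewrite /A /A'; move: (m.+1%:R) (n.+1%:R) h1 h2 h3 => a b h1 h2 h3.
by field; rewrite h1 h2 h3.
Qed.

Definition zerr (N k : nat) : R := 2 * \sum_(m < N) ((m.+1%:R ^+ 2)^-1) ^+ k * sqdiff_tail N m.

(** The diagonal gives the factor [k + 1]. Off the diagonal the geometric sums leave [sqdiff], whose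
    limit sum with factor [3/4] is taken twice; this adds [3/2], and [k + 1 + 3/2 = (k + 2) + 1/2].
    [zerr] gathers the truncation errors. *)
Lemma ztrunc_conv N k :
  \sum_(i < k.+1) ztrunc N i.+1 * ztrunc N (k.+1 - i) =
  (k.+2%:R + 2^-1) * ztrunc N k.+2 - zerr N k.+1.
Proof.
pose A (m : nat) : R := (m.+1%:R ^+ 2)^-1.
transitivity (\sum_(m < N) \sum_(n < N) \sum_(i < k.+1) A m ^+ i.+1 * A n ^+ (k.+1 - i)).
  under eq_bigr => i _ do rewrite !ztruncX big_distrlr /=.
  rewrite exchange_big /=; apply: eq_bigr => m _; rewrite exchange_big //.
have diag m : \sum_(i < k.+1) A m ^+ i.+1 * A m ^+ (k.+1 - i) = k.+1%:R * A m ^+ k.+2.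
  rewrite (eq_bigr (fun=> A m ^+ k.+2)); last first.
    by move=> i _; rewrite -exprD; congr (_ ^+ _); have := ltn_ord i; lia.
  by rewrite sumr_const card_ord mulr_natl.
transitivity (\sum_(m < N) (k.+1%:R * A m ^+ k.+2 +
    \sum_(n < N | n != m) (A m ^+ k.+1 - A n ^+ k.+1) * sqdiff m n)).
  apply: eq_bigr => m _; rewrite (bigD1 m) //= diag; congr (_ + _).
  by apply: eq_bigr => n nm; rewrite sqinv_sum_ne.
rewrite big_split /= -mulr_sumr.
(* [sqdiff] changes sign when [m] and [n] are exchanged, so both halves of the difference give the
   same double sum. *)
have -> : \sum_(m < N) \sum_(n < N | n != m) (A m ^+ k.+1 - A n ^+ k.+1) * sqdiff m n =
  2 * \sum_(m < N) A m ^+ k.+1 * \sum_(n < N | n != m) sqdiff m n.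
  rewrite mulr_natl mulr2n.
  have sw : \sum_(m < N) A m ^+ k.+1 * \sum_(n < N | n != m) sqdiff m n =
     \sum_(m < N) \sum_(n < N | n != m) - A n ^+ k.+1 * sqdiff m n.
    rewrite [RHS](exchange_big_dep predT) //=; apply: eq_bigr => m _.
    rewrite mulr_sumr; apply: eq_big => [n|n _]; first by rewrite eq_sym.
    by rewrite mulNr -mulrN -invrN opprB.
  rewrite {2}sw -big_split /=; apply: eq_bigr => m _.
  by rewrite mulr_sumr -big_split /=; apply: eq_bigr => n _; rewrite mulrDl.
rewrite /zerr [X in _ = _ - 2 * X](eq_bigr (fun m : 'I_N => 3 / 4 * A m ^+ k.+2 -
   A m ^+ k.+1 * \sum_(n < N | n != m) sqdiff m n)); last first.
  by move=> m _; rewrite (@sum_sqdiffE m N) // -/(A m) [in RHS]exprS; ring.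
rewrite ztruncX sumrB -mulr_sumr -/A.
by rewrite -[in RHS]natr1; field.
Qed.

Lemma sum_inv_sq N : \sum_(m < N) (m.+1%:R ^+ 2)^-1 <= 2 :> R.
Proof.
case: N => [|N]; first by rewrite big_ord0.
(* The constant 2 alone does not pass through the induction; this sharper bound does. *)
apply: (@le_trans _ _ (2 - (N.+1%:R)^-1)); last by rewrite gerBl invr_ge0.
elim: N => [|N IH]; first by rewrite big_ord1 expr1n invr1; lra.
rewrite big_ord_recr /=; apply: le_trans (lerD IH (lexx _)) _.
have -> : N.+2%:R = N.+1%:R + 1 :> R by rewrite natr1.
have : 0 < N.+1%:R :> R by rewrite ltr0n.
move: (N.+1%:R) => a a0.
rewrite -subr_ge0.
have -> : 2 - (a + 1)^-1 - (2 - a^-1 + ((a + 1) ^+ 2)^-1) = (a * (a + 1) ^+ 2)^-1.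
  by field; rewrite !gt_eqF // addr_gt0.
by rewrite invr_ge0 mulr_ge0 ?sqr_ge0 // ltW.
Qed.

Lemma zerr_bound N k : 0 <= zerr N k.+1 <= 6 / N.+1%:R.
Proof.
pose A (m : nat) : R := (m.+1%:R ^+ 2)^-1.
have A0 m : 0 <= A m by rewrite invr_ge0 exprn_ge0.
have A1 m : A m <= 1 by rewrite invf_le1 ?exprn_gt0 ?ltr0n // exprn_ege1 // ler1n.
rewrite /zerr; apply/andP; split.
  apply: mulr_ge0 => //; apply: sumr_ge0 => m _.
  apply: mulr_ge0; first by rewrite -/(A m); apply: exprn_ge0.
  by case/andP: (sqdiff_tail_bound (ltn_ord m)).
have -> : 6 / N.+1%:R = 2 * (3 / N.+1%:R) :> R by rewrite mulrA -natrM.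
rewrite ler_pM2l //.
(* With [M = N + 1]: 1 / (m^2 (M - m)) = (1 / m^2 + 1 / (m (M - m))) / M. *)
apply: (@le_trans _ _ (\sum_(m < N) (A m + (N%:R)^-1) / N.+1%:R)).
  apply: ler_sum => m _; have mN := ltn_ord m.
  apply: (@le_trans _ _ (A m * ((N - m)%:R)^-1)).
    have /andP[e0 e1] := sqdiff_tail_bound mN.
    apply: ler_pM; [exact: (exprn_ge0 _ (A0 m))|by []| |by []].
    by rewrite -/(A m) exprS ler_piMr // exprn_ile1.
  rewrite ler_pdivlMr ?ltr0n //.
  have -> : A m / (N - m)%:R * N.+1%:R = A m + (m.+1%:R * (N - m)%:R)^-1.
    have -> : N.+1%:R = m.+1%:R + (N - m)%:R :> R by rewrite -natrD; congr _%:R; lia.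
    have : m.+1%:R != 0 :> R by rewrite pnatr_eq0.
    have : (N - m)%:R != 0 :> R by rewrite pnatr_eq0 subn_eq0 -ltnNge.
    rewrite /A; move: (m.+1%:R) ((N - m)%:R) => a b h1 h2.
    by field; rewrite h1 h2.
  rewrite lerD2l -natrM lef_pV2 ?posrE ?ltr0n; last 2 first.
  - by rewrite muln_gt0 /= subn_gt0.
  - by lia.
  (* For [m < N] the product [(m+1)(N-m)] is least at the ends, where it equals [N]. *)
  by rewrite ler_nat; nia.
rewrite -mulr_suml ler_pM2r ?invr_gt0 ?ltr0n // big_split /= sumr_const card_ord.
(* The 2 bounds the inverse squares and the 1 bounds [N] copies of [1/N]; the final 6 is twice their
   sum. *)
have -> : 3 = 2 + 1 :> R by ring.
apply: lerD; first exact: sum_inv_sq.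
by case: N => [|N]; rewrite ?mulr0n // -[X in X <= _]mulr_natl mulfV // pnatr_eq0.
Qed.

End TruncatedZeta.

(** * Multiple zeta values as limits *)

Section Exhaustion.
Local Open Scope classical_set_scope.

Lemma sum_seq_subset (R : realType) (T : choiceType) (a : T -> R) (s u : seq T) :
  (forall x, 0 <= a x) -> uniq s -> uniq u -> {subset s <= u} ->
  \sum_(x <- s) a x <= \sum_(x <- u) a x.
Proof.
move=> a0 us uu su; rewrite [leRHS](bigID (mem s)) /= -[leLHS]addr0.
apply: lerD; last exact: sumr_ge0.
suff -> : \sum_(x <- s) a x = \sum_(x <- u | x \in s) a x by [].
rewrite -[RHS]big_filter; apply: perm_big; apply: uniq_perm => //; first exact: filter_uniq.
by move=> x; rewrite mem_filter /=; case xs: (x \in s) => //=; rewrite su.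
Qed.

(** A sum of nonnegative terms is the supremum over finite subsets of [D], and each of those lies in
    some [u N]. The bound [M] keeps it finite, so [fine] does not fall back to 0. *)
Lemma esum_exhaustion (R : realType) (T : choiceType) (D : set T) (a : T -> R)
    (u : nat -> seq T) (M : R) :
  (forall x, 0 <= a x) -> (forall N, uniq (u N)) ->
  (forall N x, x \in u N -> D x) ->
  (forall N N' : nat, (N <= N')%N -> {subset u N <= u N'}) ->
  (forall x, D x -> exists N, x \in u N) ->
  (forall N, \sum_(x <- u N) a x <= M) ->
  (fun N => \sum_(x <- u N) a x) @ \oo --> fine (\esum_(x in D) (a x)%:E).
Proof.
move=> a0 uu uD umono uex uM.
have nd : nondecreasing_seq (fun N => \sum_(x <- u N) a x).
  by move=> N N' NN'; apply: sum_seq_subset => //; exact: umono.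
have ub : has_ubound (range (fun N => \sum_(x <- u N) a x)).
  by exists M => _ [N _ <-].
have := nondecreasing_cvgn nd ub; set S := sup _ => cvS.
suff -> : fine (\esum_(x in D) (a x)%:E) = S by [].
have US N : \sum_(x <- u N) a x <= S by apply: ub_le_sup => //; exists N.
have le1 : (\esum_(x in D) (a x)%:E <= S%:E)%E.
  apply: ge_ereal_sup => _ [A [finA AD] <-].
  rewrite fsbig_finite //= sumEFin lee_fin.
  have [N HN] : exists N, forall x, x \in fset_set A -> x \in u N.
    suff H (s : seq T) : (forall x, x \in s -> D x) ->
        exists N, forall x, x \in s -> x \in u N.
      by apply: H => x; rewrite in_fset_set // inE => /AD.
    elim: s => [|x s IH] sD; first by exists 0%N.
    have [|N HN] := IH; first by move=> y ys; apply: sD; rewrite inE ys orbT.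
    have [N' HN'] := uex x (sD x (mem_head _ _)).
    exists (maxn N N') => y; rewrite inE => /predU1P[->|/HN].
      exact: umono (leq_maxr _ _) _ HN'.
    exact: umono (leq_maxl _ _) _.
  apply: le_trans (US N); apply: sum_seq_subset => //.
have ge0 : (0 <= \esum_(x in D) (a x)%:E)%E by apply: esum_ge0 => x _; rewrite lee_fin.
have fin : (\esum_(x in D) (a x)%:E)%E \is a fin_num.
  by rewrite ge0_fin_numE //; apply: le_lt_trans le1 _; rewrite ltry.
apply/eqP; rewrite eq_le; apply/andP; split.
  by rewrite -lee_fin fineK.
apply: ge_sup; first by exists (\sum_(x <- u 0%N) a x), 0%N.
move=> _ [N _ <-]; rewrite -lee_fin fineK // -sumEFin.
apply: esum_ge; exists [set` u N].
  by split; [exact: finite_seq|move=> x /=; exact: uD].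
by rewrite -fsbig_seq.
Qed.

Lemma sum_tuple_prod (R : realType) n N (f : 'I_n -> 'I_N -> R) :
  \sum_(t : n.-tuple 'I_N) \prod_(i < n) f i (tnth t i) = \prod_(i < n) \sum_(x < N) f i x.
Proof.
elim: n f => [|n IH] f.
  rewrite big_ord0 (eq_bigr (fun=> 1)); last by move=> t _; rewrite big_ord0.
  by rewrite sumr_const card_tuple expn0.
rewrite sum_tuple_cons big_ord_recl -IH mulr_suml; apply: eq_bigr => x _.
rewrite mulr_sumr; apply: eq_bigr => t _; rewrite big_ord_recl tnth0.
by congr (_ * _); apply: eq_bigr => i _; rewrite tnthS.
Qed.

End Exhaustion.

Section TruncatedMZV.
Variables (R : realType) (n : nat).
Local Open Scope classical_set_scope.
Implicit Type s : 'I_n -> nat.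

Definition mztrunc (star : bool) (N : nat) s : R :=
  \sum_(t : n.-tuple 'I_N | mz_sorted star t) \prod_(i < n) ((tnth t i).+1%:R ^+ s i)^-1.

Definition mz_dom (star : bool) := if star then @mzsv_dom n else @mzv_dom n.

Definition succ_ffun N (t : n.-tuple 'I_N) : {ffun 'I_n -> nat} :=
  [ffun i => (tnth t i).+1].

Lemma succ_ffun_inj N : injective (@succ_ffun N).
Proof.
move=> t t' /ffunP E; apply: eq_from_tnth => i; apply: val_inj.
by have := E i; rewrite !ffunE => -[].
Qed.

Lemma mz_sortedP star N (t : n.-tuple 'I_N) : reflect (mz_dom star (succ_ffun t)) (mz_sorted star t).
Proof.
have sP : reflect (forall i j : 'I_n, (i < j)%N -> (tnth t j <= tnth t i)%N)
                  (sorted (@ordgeq N) t).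
  (* The case [n = 0] is split off next, since an empty tuple offers no default element for
     [nth]. *)
  rewrite sorted_pairwise; last exact: ordgeq_trans.
  case: (posnP n) => [t0|n0].
    have t00 : val t = [::] by apply: size0nil; rewrite size_tuple.
    by rewrite [tval t]t00; apply: ReflectT => -[i ilt]; exfalso; rewrite t0 in ilt.
  have x0 := tnth t (Ordinal n0).
  apply: (iffP (pairwiseP x0)) => [H i j ij|H i j].
    by rewrite !(tnth_nth x0); apply: H; rewrite ?inE ?size_tuple.
  rewrite !inE size_tuple => hi hj ij.
  by have := H (Ordinal hi) (Ordinal hj) ij; rewrite !(tnth_nth x0).
have uP : reflect (forall i j : 'I_n, (i < j)%N -> tnth t i != tnth t j) (uniq t).
  apply: (iffP (tuple_uniqP t)) => [inj i j ij|H i j /eqP tij].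
    by apply: contraTN ij => /eqP /inj ->; rewrite ltnn.
  apply: val_inj; apply/eqP; apply: contraTT tij; rewrite neq_ltn => /orP[/H //|/H].
  by rewrite eq_sym.
rewrite /mz_sorted /mz_dom; case: star => /=; rewrite ?andbT.
  apply: (iffP sP) => [H|[H _] i j /H]; last by rewrite !ffunE.
  by split=> [i j /H|i]; rewrite !ffunE.
apply: (iffP andP) => [[/sP H /uP H']|[H _]].
  split=> [i j ij|i]; rewrite !ffunE // !ltnS ltn_neqAle H // andbT eq_sym.
  exact: H'.
split; [apply/sP|apply/uP] => i j /H; rewrite !ffunE !ltnS; first exact: ltnW.
by rewrite ltn_neqAle eq_sym => /andP[].
Qed.

(** The boxes [x i <= N] exhaust the domain. Once the order condition is dropped, the sum factors
    into [n] sums, each at most a sum of inverse squares and hence at most 2; this gives the bound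
    [2^n]. *)
Lemma mztrunc_cvg star s : (forall i, (1 < s i)%N) ->
  mztrunc star N s @[N --> \oo] -->
    fine (\esum_(m in mz_dom star) (mz_term R s m)%:E).
Proof.
move=> s2.
pose u N := [seq succ_ffun t | t <- [seq t : n.-tuple 'I_N <- enum {: n.-tuple 'I_N} | mz_sorted star t]].
have uE N x : reflect (mz_dom star x /\ forall i, (x i <= N)%N) (x \in u N).
  apply: (iffP mapP) => [[t]|[Dx xN]].
    rewrite mem_filter => /andP[/mz_sortedP dt _] ->; split=> // i.
    by rewrite ffunE.
  have x0 i : (0 < x i)%N by move: Dx; rewrite /mz_dom; case: (star) => -[_]; apply.
  have xN' i : ((x i).-1 < N)%N by rewrite prednK.
  have xE : x = succ_ffun [tuple Ordinal (xN' i) | i < n].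
    by apply/ffunP => i; rewrite ffunE tnth_mktuple /= prednK.
  exists [tuple Ordinal (xN' i) | i < n] => //.
  by rewrite mem_filter mem_enum andbT; apply/mz_sortedP; rewrite -xE.
have E N : mztrunc star N s = \sum_(x <- u N) mz_term R s x.
  rewrite big_map big_filter big_enum_cond /=; apply: eq_bigr => t _.
  rewrite /mz_term prodfV; congr (_^-1); apply: eq_bigr => i _.
  by rewrite ffunE.
rewrite (_ : (fun N => mztrunc star N s) = (fun N => \sum_(x <- u N) mz_term R s x)); last first.
  exact/funext.
apply: (@esum_exhaustion _ _ _ _ _ (2 ^+ n)).
- by move=> x; rewrite invr_ge0 prodr_ge0 // => i _; rewrite exprn_ge0.
- move=> N; rewrite map_inj_uniq; [exact/filter_uniq/enum_uniq|exact: succ_ffun_inj].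
- by move=> N x /uE[].
- move=> N N' NN' x /uE[Dx xN]; apply/uE; split => // i; exact: leq_trans (xN i) NN'.
- move=> x Dx; exists (\max_(i < n) x i); apply/uE; split => // i.
  exact: (leq_bigmax i).
move=> N; rewrite -E.
apply: (@le_trans _ _ (\sum_(t : n.-tuple 'I_N) \prod_(i < n) ((tnth t i).+1%:R ^+ s i)^-1)).
  rewrite /mztrunc [leRHS](bigID (fun t : n.-tuple 'I_N => mz_sorted star t)) /= lerDl sumr_ge0 // => t _.
  by rewrite prodr_ge0 // => i _; rewrite invr_ge0 exprn_ge0.
rewrite (sum_tuple_prod (fun i x => (x.+1%:R ^+ s i)^-1)).
rewrite -[n in 2 ^+ n]card_ord -prodr_const; apply: ler_prod => i _.
rewrite sumr_ge0 /=; last by move=> x _; rewrite invr_ge0 exprn_ge0.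
apply: le_trans (sum_inv_sq _ N); apply: ler_sum => x _.
rewrite lef_pV2 ?posrE ?exprn_gt0 ?ltr0n //.
by apply: ler_weXn2l => //; rewrite ler1n.
Qed.

End TruncatedMZV.

(** * Even zeta values: Euler's convolution, rationality and the Riccati equation *)

Section EvenZetaLimits.
Local Open Scope classical_set_scope.

Lemma cvg_sumr (R : realType) (I : Type) (s : seq I) (P : pred I) (f : I -> nat -> R) (l : I -> R) :
  (forall i, P i -> f i N @[N --> \oo] --> l i) ->
  (\sum_(i <- s | P i) f i N) @[N --> \oo] --> \sum_(i <- s | P i) l i.
Proof.
move=> H; elim: s => [|i s IH].
  under eq_fun do rewrite big_nil.
  by rewrite big_nil; exact: cvg_cst.
under eq_fun do rewrite big_cons.
rewrite big_cons; case: ifP => // Pi; apply: cvgD => //; exact: H.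
Qed.

End EvenZetaLimits.

Section EvenZeta.
Variable R : realType.
Local Open Scope classical_set_scope.

Definition zeven (k : nat) : R := zeta R (2 * k).

Lemma zeven0 : zeven 0 = - 2^-1.
Proof. by []. Qed.

Lemma ztrunc_cvg k : ztrunc R N k.+1 @[N --> \oo] --> zeven k.+1.
Proof.
have := @mztrunc_cvg R 1 false (fun=> (2 * k.+1)%N).
have k2 (i : 'I_1) : (1 < 2 * k.+1)%N by rewrite mulnS.
move=> /(_ k2).
rewrite (_ : (fun N => mztrunc _ _ _ _) = (fun N => ztrunc R N k.+1)) //.
apply/funext => N; rewrite /mztrunc (eq_bigl predT); last first.
  by case=> -[|x [|y s]].
rewrite (sum_tuple_prod (fun (i : 'I_1) (x : 'I_N) => (x.+1%:R ^+ (2 * k.+1))^-1)).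
by rewrite big_ord1.
Qed.

Lemma zeven_conv k :
  \sum_(i < k.+1) zeven i.+1 * zeven (k.+1 - i) = (k.+2%:R + 2^-1) * zeven k.+2.
Proof.
have c1 : (\sum_(i < k.+1) ztrunc R N i.+1 * ztrunc R N (k.+1 - i)) @[N --> \oo] -->
   \sum_(i < k.+1) zeven i.+1 * zeven (k.+1 - i).
  apply: cvg_sumr => i _; apply: cvgM; first exact: ztrunc_cvg.
  by rewrite subSn -1?ltnS //; exact: ztrunc_cvg.
have c2 : ((k.+2%:R + 2^-1) * ztrunc R N k.+2 - zerr R N k.+1) @[N --> \oo] -->
   (k.+2%:R + 2^-1) * zeven k.+2 - 0.
  apply: cvgB; first by apply: cvgMl_tmp; exact: ztrunc_cvg.
  apply: (@squeeze_cvgr _ _ _ _ (fun=> 0) (fun N => 6 * N.+1%:R^-1)).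
  - by apply: nearW => N; exact: zerr_bound.
  - exact: cvg_cst.
  - by rewrite -[X in _ --> X](mulr0 6); apply: cvgMl_tmp; exact: cvg_harmonic.
rewrite subr0 in c2; move: c1; under eq_fun do rewrite ztrunc_conv; move=> c1.
exact: cvg_unique c1 c2.
Qed.

Lemma zeven_gt0 k : 0 < zeven k.+1.
Proof.
have nd : nondecreasing_seq (fun N => ztrunc R N k.+1).
  apply/nondecreasing_seqP => N; rewrite /ztrunc big_ord_recr /= lerDl.
  by rewrite invr_ge0 exprn_ge0.
have c := @ztrunc_cvg k.
have /(_ 1%N) := nondecreasing_cvgn_le nd (cvgP _ c).
rewrite (cvg_lim _ c) // /ztrunc big_ord1 expr1n invr1.
exact: lt_le_trans.
Qed.

Definition tau : R := 3 / 2 * zeven 1.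

(** Euler's convolution expresses each value from [zeta(4)] on through lower ones, so strong
    induction gives a rational factor. It is nonzero because [zeven k] is, which later lets
    [tau ^+ l] be traded for [zeta(2l)]. *)
Lemma zeven_tau k : exists2 c : rat, c != 0 & zeven k = ratr c * tau ^+ k.
Proof.
elim/ltn_ind: k => m IH.
have [c E] : exists c : rat, zeven m = ratr c * tau ^+ m.
  case: m IH => [|[|k]] IH.
  - by exists (- 2^-1); rewrite zeven0 rmorphN fmorphV mulr1 rmorph_nat.
  - by exists (2 / 3); rewrite /tau expr1 rmorphM fmorphV !rmorph_nat; field.
  (* The range condition sits inside the existential so that choice yields a total function, with
     default 0. *)
  have H i : exists c : rat, (i < k.+1)%N -> zeven i.+1 = ratr c * tau ^+ i.+1.
    have [ik|] := boolP (i < k.+1)%N; last by exists 0.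
    by have [|c _ ->] := IH i.+1; [rewrite ltnS|exists c].
  have [f Hf] := boolp.choice H.
  exists ((\sum_(i < k.+1) f i * f (k - i)%N) / (k.+2%:R + 2^-1)).
  have nz : k.+2%:R + 2^-1 != 0 :> R by rewrite gt_eqF // addr_gt0 // ltr0n.
  apply: (mulfI nz); rewrite -zeven_conv rmorphM fmorphV rmorphD fmorphV !rmorph_nat.
  rewrite mulrA [_ * (_ / _)]mulrC divfK // rmorph_sum mulr_suml; apply: eq_bigr => i _.
  have := ltn_ord i; rewrite ltnS => ik.
  rewrite subSn // !Hf ?ltnS ?leq_subr // rmorphM.
  have -> : tau ^+ k.+2 = tau ^+ i.+1 * tau ^+ (k - i).+1.
    by rewrite -exprD; congr (_ ^+ _); lia.
  ring.
exists c => //; apply/eqP => c0; move: E; rewrite c0 rmorph0 mul0r; case: m {IH}.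
  by rewrite zeven0 => /eqP; rewrite oppr_eq0 invr_eq0 pnatr_eq0.
by move=> k /eqP; rewrite gt_eqF // zeven_gt0.
Qed.

Definition zseries : pseries R := zeven.
Definition tseries : pseries R := ps_mono tau 1.

(** Coefficient 0 balances because [zeta(0) = -1/2], and coefficient 1 fixes the value of [tau].
    From coefficient 2 on, the end terms of the Cauchy square contribute [- zeta(2k)], which with
    the linear term turns Euler's factor [k + 1/2] into [k]. *)
Lemma zseries_riccati :
  ps_euler zseries = zseries ^+ 2 + ps_const 2^-1 * zseries + tseries.
Proof.
apply/funext => -[|[|k]]; rewrite !ps_addE ps_constM expr2 ps_mulE /ps_euler /tseries /ps_mono /=.
- by rewrite big_ord1 /zseries zeven0; field.
- by rewrite big_ord_recl big_ord1 /= /zseries zeven0 /tau; field.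
rewrite big_ord_recl big_ord_recr /= subn0 [bump 0 k.+1]add1n subnn.
rewrite (eq_bigr (fun i : 'I_k.+1 => zeven i.+1 * zeven (k.+1 - i)%N)) ?zeven_conv //.
by rewrite /zseries zeven0; field.
Qed.

End EvenZeta.

(** * The generating functions *)

Section PairRing.
Variable R : realType.
Local Open Scope classical_set_scope.

(* The two solutions of the Riccati equation, computed side by side. *)
Definition zring : Type := (pseries R * {poly rat})%type.
HB.instance Definition _ := GRing.ComNzRing.on zring.

Lemma zring_ext (x y : zring) : x.1 = y.1 -> x.2 = y.2 -> x = y.
Proof. by case: x y => [? ?] [? ?] /= -> ->. Qed.

Definition zscal (a : rat) : zring := (ps_const (ratr a), a%:P).

Fact zscal_is_additive : zmod_morphism zscal.
Proof. by move=> a b; apply: zring_ext; rewrite /= !rmorphB. Qed.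
Fact zscal_is_monoid_morphism : monoid_morphism zscal.
Proof.
split=> [|a b]; apply: zring_ext.
- by rewrite [LHS]/= [ratr 1]rmorph1.
- by [].
- by rewrite [LHS]/= [ratr _]rmorphM [LHS]rmorphM.
- exact: polyCM.
Qed.
HB.instance Definition _ := GRing.isZmodMorphism.Build rat zring zscal zscal_is_additive.
HB.instance Definition _ := GRing.isMonoidMorphism.Build rat zring zscal zscal_is_monoid_morphism.

Definition zder (x : zring) : zring := (ps_euler x.1, 2^-1 *: ('X * x.2^`())).
Definition zW : zring := (zseries R, 'X).
Definition zt : zring := (tseries R, - 'X^2).

Lemma zderD x y : zder (x + y) = zder x + zder y.
Proof.
by rewrite /zder ps_eulerD derivD mulrDr scalerDr.
Qed.

Lemma zderM x y : zder (x * y) = zder x * y + x * zder y.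
Proof.
apply: zring_ext; first exact: ps_eulerM.
rewrite /= derivM mulrDr scalerDr -!scalerAl -!scalerAr; congr (_ *: _ + _ *: _); ring.
Qed.

Lemma zder_scal a : zder (zscal a) = 0.
Proof.
apply: zring_ext; last by rewrite /= derivC mulr0 scaler0.
by apply/funext => -[|k]; rewrite /= /ps_euler /= ?mul0r ?mulr0.
Qed.

Lemma zder_zt : zder zt = zt.
Proof.
apply: zring_ext.
  apply/funext => k; rewrite /= /ps_euler /tseries /ps_mono.
  by case: eqP => [->|_]; rewrite ?mul1r ?mulr0.
rewrite /zder /zt /= derivN derivXn /= expr1.
apply: (@scalerI _ _ 2) => //; rewrite scalerA mulfV // scale1r scaler_nat; ring.
Qed.

Lemma zder_zW : zder zW = zW ^+ 2 + zscal 2^-1 * zW + zt.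
Proof.
apply: zring_ext; first by rewrite [LHS]/= zseries_riccati /= fmorphV rmorph_nat.
by rewrite /= derivX mulr1 mul_polyC addrAC expr2 subrr add0r.
Qed.

Lemma zring_fstX (x : zring) l : (x ^+ l).1 = x.1 ^+ l.
Proof. by elim: l => // l IH; rewrite !exprS /= IH. Qed.
Lemma zring_sndX (x : zring) l : (x ^+ l).2 = x.2 ^+ l.
Proof. by elim: l => // l IH; rewrite !exprS /= IH. Qed.
Lemma zring_fst_sum (I : Type) (s : seq I) (P : pred I) (F : I -> zring) :
  (\sum_(i <- s | P i) F i).1 = \sum_(i <- s | P i) (F i).1.
Proof. by elim/big_rec2: _ => // i x y _ <-. Qed.
Lemma zring_snd_sum (I : Type) (s : seq I) (P : pred I) (F : I -> zring) :
  (\sum_(i <- s | P i) F i).2 = \sum_(i <- s | P i) (F i).2.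
Proof. by elim/big_rec2: _ => // i x y _ <-. Qed.

Lemma iter_zder_fst j k : (iter j zder zW).1 k = k%:R ^+ j * zeven R k.
Proof.
elim: j => [|j IH]; first by rewrite mul1r.
by rewrite iterS /= /ps_euler IH exprS mulrA.
Qed.

Lemma iter_zder_snd j : (iter j zder zW).2 = (2^-1) ^+ j *: 'X.
Proof.
elim: j => [|j IH]; first by rewrite scale1r.
by rewrite iterS /= IH derivZ derivX -scalerAr mulr1 scalerA exprS.
Qed.

Notation zwt := (wt zscal zt zW).

(* The correction at [e = 0] removes the constant term [zeta(0) = -1/2]. *)
Definition zpow (g : {poly rat}) : zring :=
  \sum_(e < size g) zscal g`_e * (iter e zder zW + zscal (if e == 0%N :> nat then 2^-1 else 0)).

Lemma zpow_wt (g : {poly rat}) : zwt (size g) (zpow g).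
Proof.
apply: wt_sum => e _; apply: wt_scale; apply: wtD; last exact: wt_const.
apply: wt_le (ltn_ord e) _.
by apply: wt_iter; [exact: zderD|exact: zderM|exact: zder_scal|exact: zder_zt|exact: zder_zW].
Qed.

(** On the polynomial side every [delta^j W] is a multiple of [s], so the degree is at most 1
    whatever the degree of [g]. *)
Lemma zpow_snd (g : {poly rat}) : (size (zpow g).2 <= 2)%N.
Proof.
rewrite zring_snd_sum; apply: leq_trans (size_sum _ _ _) _; apply/bigmax_leqP => e _ /=.
rewrite mul_polyC; apply: leq_trans (size_scale_leq _ _) _.
apply: leq_trans (size_polyD _ _) _; rewrite geq_max iter_zder_snd; apply/andP; split.
  by apply: leq_trans (size_scale_leq _ _) _; rewrite size_polyX.
by apply: leq_trans (size_polyC_leq1 _) _.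
Qed.

Lemma zpow_fst (g : {poly rat}) k : (zpow g).1 k = if k is 0%N then 0 else ratr g.[k%:R] * zeven R k.
Proof.
rewrite zring_fst_sum ps_sumE.
have E (e : 'I_(size g)) : (zscal g`_e * (iter e zder zW
     + zscal (if e == 0%N :> nat then 2^-1 else 0))).1 k =
   if k is 0%N then 0 else ratr (g`_e * k%:R ^+ e) * zeven R k.
  rewrite /= ps_constM ps_addE iter_zder_fst.
  case: k => [|k] /=; last by rewrite addr0 mulrA rmorphM rmorphXn rmorph_nat.
  case: (e : nat) => [|e'] /=.
    by rewrite mul1r zeven0 fmorphV rmorph_nat addNr mulr0.
  by rewrite exprS mul0r mul0r rmorph0 addr0 mulr0.
rewrite (eq_bigr _ (fun e _ => E e)); case: k {E} => [|k]; first by rewrite big1.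
by rewrite -mulr_suml -rmorph_sum horner_coef.
Qed.

Definition hseries (g : {poly rat}) (m : nat) : pseries R :=
  fun k => if k is 0%N then 0 else ratr g.[k%:R] * (m.+1%:R ^+ (2 * k))^-1.

(** How equal entries merge: at a fixed [m] both factors are series in [u/(m+1)^2], so only their
    polynomial coefficients are convolved. *)
Lemma hseriesM (g g' S : {poly rat}) m :
  (forall k : nat, S.[k.+1%:R] = \sum_(a < k) g.[a.+1%:R] * g'.[(k - a)%:R]) ->
  hseries g m * hseries g' m = hseries S m.
Proof.
move=> HS; apply/funext => -[|k]; rewrite ps_mulE; first by rewrite big_ord1 mul0r.
rewrite big_ord_recl mul0r add0r big_ord_recr /= [bump 0 k]add1n subnn mulr0 addr0.
rewrite HS rmorph_sum mulr_suml; apply: eq_bigr => i _ /=.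
rewrite /bump /= add1n subSS.
have ik := ltn_ord i; rewrite -(subnSK ik) rmorphM /=.
have -> : (2 * k.+1 = 2 * i.+1 + 2 * (k - i.+1).+1)%N by lia.
rewrite exprD invfM; ring.
Qed.

Definition msum (star : bool) (n N : nat) (gs : nat -> {poly rat}) : pseries R :=
  \sum_(t : n.-tuple 'I_N) ps_const (star_weight R star t) * \prod_(i < n) hseries (gs i) (tnth t i).

(** The head's weight [1 + star_sign * count] is expanded: the 1 splits the head off as a free
    factor, and each coincidence with entry [i] of the tail fuses two polynomials into [S i]. All
    remaining sums have depth [n]. *)
Lemma msumS star n N gs S :
  (forall i (k : nat), (S i).[k.+1%:R] = \sum_(a < k) (gs 0%N).[a.+1%:R] * (gs i.+1).[(k - a)%:R]) ->
  msum star n.+1 N gs = (\sum_(m < N) hseries (gs 0%N) m) * msum star n N (fun i => gs i.+1)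
    + \sum_(i < n) ps_const (star_sign R star) *
       msum star n N (fun j => if j == i then S i else gs j.+1).
Proof.
move=> HS; rewrite /msum sum_tuple_cons mulr_suml.
pose T (t : n.-tuple 'I_N) : pseries R :=
  ps_const (star_weight R star t) * \prod_(i < n) hseries (gs i.+1) (tnth t i).
transitivity (\sum_(x < N) \sum_(t : n.-tuple 'I_N) (hseries (gs 0%N) x * T t +
   \sum_(i < n) if tnth t i == x then ps_const (star_sign R star) * (hseries (gs 0%N) x * T t) else 0)).
  apply: eq_bigr => x _; apply: eq_bigr => t _.
  rewrite big_ord_recl tnth0.
  rewrite (eq_bigr (fun i : 'I_n => hseries (gs i.+1) (tnth t i))); last first.
    by move=> i _; rewrite tnthS.
  rewrite [star_weight _ _ _]/=.
  have -> : (count_mem x t)%:R = \sum_(i < n) (tnth t i == x)%:R :> R.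
    by rewrite -natr_sum -sum1_count big_tuple big_mkcond.
  rewrite rmorphM rmorphD rmorph1 rmorphM rmorph_sum mulrDr mulr1 mulrDl.
  congr (_ + _); first by rewrite mulrCA.
  rewrite mulr_sumr mulr_sumr mulr_suml; apply: eq_bigr => i _.
  case: eqP => _; last by rewrite rmorph0 !mulr0 mul0r.
  by rewrite rmorph1 mulr1 /T; ring.
rewrite exchange_big /=.
under eq_bigr => t _ do rewrite big_split /=.
rewrite big_split /= exchange_big /=; congr (_ + _).
  by apply: eq_bigr => x _; rewrite mulr_sumr.
under eq_bigr => t _ do rewrite exchange_big /=.
rewrite exchange_big /=; apply: eq_bigr => i _.
rewrite mulr_sumr; apply: eq_bigr => t _.
rewrite -big_mkcond /= (big_pred1 (tnth t i)); last by move=> x; rewrite /= eq_sym.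
congr (_ * _); rewrite /T mulrCA; congr (_ * _).
rewrite (bigD1 i) //= [in RHS](bigD1 i) //= eqxx mulrA (hseriesM _ (HS i)).
by congr (_ * _); apply: eq_bigr => j; rewrite -val_eqE /= => /negbTE ->.
Qed.

(** Induction through [msumS]. [conv_poly] bounds the size of a merged polynomial by the two sizes
    it replaces, so merging does not raise the weight. A free factor adds at most one to the degree
    of the second component, and merging adds none. *)
Lemma msum_limit star n (gs : nat -> {poly rat}) : exists x : zring,
  [/\ zwt (\sum_(i < n) size (gs i)) x, (size x.2 <= n.+1)%N &
      forall k, msum star n N gs k @[N --> \oo] --> x.1 k].
Proof.
elim: n gs => [|n IH] gs.
  exists 1; split.
  - by rewrite big_ord0 -(rmorph1 zscal); exact: wt_const.
  - by rewrite size_poly1.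
  move=> k; rewrite (_ : (fun N => _) = fun=> (1 : pseries R) k); first exact: cvg_cst.
  apply/funext => N; rewrite /msum (eq_bigr (fun=> 1)); last first.
    by move=> t _; rewrite big_ord0 mulr1 (tuple0 t) /= rmorph1.
  by rewrite sumr_const card_tuple expn0.
have HS i : exists S : {poly rat}, (size S <= size (gs 0%N) + size (gs i.+1))%N /\
    forall k : nat, S.[k.+1%:R] = \sum_(a < k) (gs 0%N).[a.+1%:R] * (gs i.+1).[(k - a)%:R].
  by have [S ? ?] := conv_poly (gs 0%N) (gs i.+1); exists S.
have [S HS'] := boolp.choice HS.
have [x0 [wx0 sx0 cx0]] := IH (fun i => gs i.+1).
have [x Hx] := boolp.choice (fun i => IH (fun j => if j == i then S i else gs j.+1)).
exists (zpow (gs 0%N) * x0 + \sum_(i < n) zscal (star_sign rat star) * x i); split.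
- rewrite big_ord_recl; apply: wtD; first by apply: wtM => //; exact: zpow_wt.
  apply: wt_sum => i _; apply: wt_scale; have [wx _ _] := Hx i.
  apply: wt_le wx; rewrite (bigD1 i) //= eqxx [in leqRHS](bigD1 i) //= addnA.
  apply: leq_add; first by case: (HS' i).
  by apply: leq_sum => j; rewrite -val_eqE /= => /negbTE ->.
- rewrite /= [X in _ + X]zring_snd_sum; apply: leq_trans (size_polyD _ _) _; rewrite geq_max; apply/andP; split.
    apply: leq_trans (size_polyMleq _ _) _; rewrite -subn1 leq_subLR.
    exact: leq_trans (leq_add (zpow_snd _) sx0) _.
  apply: leq_trans (size_sum _ _ _) _; apply/bigmax_leqP => i _ /=.
  rewrite mul_polyC; apply: leq_trans (size_scale_leq _ _) _.
  by have [_ sx _] := Hx i; apply: leq_trans sx _.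
move=> k; pose A N := \sum_(m < N) hseries (gs 0%N) m.
pose C i N := msum star n N (fun j => if j == i then S i else gs j.+1).
rewrite (_ : (fun N => _) = fun N =>
  \sum_(i < k.+1) A N i * msum star n N (fun i => gs i.+1) (k - i)%N +
  \sum_(i < n) star_sign R star * C i N k); last first.
  apply/funext => N; rewrite (msumS _ _ _ (fun i => (HS' i).2)) ps_addE ps_mulE ps_sumE.
  by congr (_ + _); apply: eq_bigr => i _; rewrite ps_constM.
rewrite /= [X in _ + X]zring_fst_sum ps_addE ps_mulE ps_sumE; apply: cvgD.
  apply: cvg_sumr => i _; apply: cvgM; last exact: cx0.
  rewrite zpow_fst (_ : (fun N => _) = fun N =>
     if i : nat is 0%N then 0 else ratr (gs 0%N).[i%:R] * ztrunc R N i); last first.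
    apply/funext => N; rewrite /A ps_sumE /hseries.
    by case: (i : nat) => [|j]; [rewrite big1|rewrite mulr_sumr].
  case: (i : nat) => [|j] /=; first exact: cvg_cst.
  by apply: cvgMl_tmp; exact: ztrunc_cvg.
apply: cvg_sumr => i _; rewrite [X in _ --> X]ps_constM.
have -> : ratr (star_sign rat star) = star_sign R star.
  by rewrite /star_sign; case: (star); rewrite ?rmorphN rmorph1.
by apply: cvgMl_tmp; have [_ _ cx] := Hx i; exact: cx.
Qed.

End PairRing.

(** * Sums weighted by a symmetric polynomial *)

Lemma meval_symmetric n (K : comNzRingType) (F : mpoly.mpoly n K) (v : 'I_n -> K) (p : 'S_n) :
  F \is mpoly.symmetric -> mpoly.meval (fun i => v (p i)) F = mpoly.meval v F.
Proof.
move=> /mpoly.issymP/(_ p) Fp.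
have E : mpoly.msym p F =
    \sum_(m <- mpoly.msupp F) mpoly.mcoeff m F *: mpoly.msym p (mpoly.mpolyX K m).
  rewrite {1}[F]mpoly.mpolyE raddf_sum; apply: eq_bigr => m _.
  exact: mpoly.msymZ.
rewrite -[F in RHS]Fp E {1}[F]mpoly.mpolyE !raddf_sum.
apply: eq_bigr => m _; rewrite mpoly.msymX /= !mpoly.mevalZ !mpoly.mevalX.
congr (_ * _); rewrite [RHS](reindex_inj (@perm_inj _ p)) /=; apply: eq_bigr => i _.
by rewrite mpoly.mnmE permK.
Qed.

Lemma ps_prod_trunc (R : comNzRingType) (I : Type) (s : seq I) (f : I -> pseries R) K k :
  (k <= K)%N -> (\prod_(i <- s) f i) k = (\prod_(i <- s) ps_trunc K (f i))`_k.
Proof.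
elim: s k => [|i s IH] k kK; first by rewrite !big_nil ps_oneE coef1.
rewrite !big_cons ps_mulE coefM; apply: eq_bigr => j _; have jk := ltn_ord j.
by rewrite IH ?coef_poly ?ifT //; lia.
Qed.

Lemma ps_prodE (R : comNzRingType) n (f : 'I_n -> pseries R) k :
  (\prod_(i < n) f i) k =
  \sum_(a : {ffun 'I_n -> 'I_k.+1} | (\sum_(i < n) a i)%N == k) \prod_(i < n) f i (a i).
Proof.
rewrite (ps_prod_trunc _ _ (leqnn k)) [RHS]big_mkcond.
under eq_bigr do rewrite /ps_trunc poly_def.
rewrite bigA_distr_bigA /= coef_sum; apply: eq_bigr => a _.
rewrite scaler_prod coefZ prodrXr coefXn eq_sym.
by case: eqP => _; rewrite ?mulr1 ?mulr0.
Qed.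

Section Weighted.
Variables (R : realType) (n : nat).
Local Open Scope classical_set_scope.

Definition mz star (s : 'I_n -> nat) : R := fine (\esum_(m in @mz_dom n star) (mz_term R s m)%:E).

Notation zwt := (wt (@zscal R) (@zt R) (@zW R)).

Variable F : mpoly.mpoly n rat.

Definition wterm k N (t : n.-tuple 'I_N) : R :=
  \sum_(a : {ffun 'I_n -> 'I_k.+1} | is_composition a)
    ratr (mpoly.meval (fun j => (a j)%:R) F) *
      \prod_(i < n) ((tnth t i).+1%:R ^+ (2 * a i))^-1.

(** Permuting the entries of the tuple is undone by permuting the composition, which [F] does not
    notice. *)
Lemma wterm_perm k N (s t : n.-tuple 'I_N) : F \is mpoly.symmetric ->
  perm_eq s t -> wterm k s = wterm k t.
Proof.
move=> Fsym /tuple_permP[p /val_inj sE].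
have {sE} sE i : tnth s i = tnth t (p i) by rewrite sE tnth_mktuple.
pose h (a : {ffun 'I_n -> 'I_k.+1}) : {ffun 'I_n -> 'I_k.+1} := [ffun i => a (p i)].
have hbij : bijective h.
  exists (fun a : {ffun 'I_n -> 'I_k.+1} => [ffun i => a (p^-1%g i)]) => a; apply/ffunP => i.
    by rewrite !ffunE permKV.
  by rewrite !ffunE permK.
rewrite /wterm (reindex h) /=; last exact: onW_bij.
apply: eq_big => a.
  rewrite /is_composition; congr (_ && _).
    apply/forallP/forallP => H j; last by rewrite ffunE.
    by have := H (p^-1%g j); rewrite ffunE permKV.
  congr (_ == _); rewrite [RHS](reindex_inj (@perm_inj _ p)) /=.
  by apply: eq_bigr => i _; rewrite ffunE.
move=> _; congr (ratr _ * _).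
  rewrite -(meval_symmetric (fun j => (a j)%:R) p Fsym); apply: mpoly.meval_eq => i.
  by rewrite ffunE.
rewrite [RHS](reindex_inj (@perm_inj _ p)) /=.
by apply: eq_bigr => i _; rewrite ffunE sE.
Qed.

(** Indexed by [nat], as the recursion on the depth shifts the family; past [n] the value is the
    constant 1. *)
Definition mono_polys (m : mpoly.multinom n) (i : nat) : {poly rat} :=
  'X^(oapp (fun j : 'I_n => m j) 0%N (insub i)).

Lemma wtermE k N (t : n.-tuple 'I_N) :
  wterm k t = \sum_(m <- mpoly.msupp F) ratr (mpoly.mcoeff m F) *
    (\prod_(i < n) hseries R (mono_polys m i) (tnth t i)) k.
Proof.
under [RHS]eq_bigr do rewrite ps_prodE mulr_sumr.
rewrite exchange_big /= [RHS](bigID (fun a : {ffun 'I_n -> 'I_k.+1} => [forall j, (1 <= a j)%N])) /=.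
(* Tuples with a zero part drop out because [hseries] has no constant term. *)
rewrite [X in _ = _ + X]big1 ?addr0; last first.
  move=> a /andP[_ /forallPn[j]]; rewrite -eqn0Ngt => /eqP aj.
  by rewrite big1 // => m _; rewrite (bigD1 j) //= aj mul0r mulr0.
apply: eq_big => [a|a /andP[/forallP a1 _]]; first by rewrite andbC.
rewrite mpoly.mevalE rmorph_sum mulr_suml; apply: eq_bigr => m _.
rewrite rmorphM -mulrA; congr (_ * _); rewrite rmorph_prod -big_split /=.
apply: eq_bigr => i _; have := a1 i; case: (a i : nat) => // j _ /=.
by rewrite /mono_polys valK hornerXn.
Qed.

(** Symmetrisation turns the truncated weighted sums into combinations of [msum], and limits are
    unique. A monomial of degree [d] yields weight at most [d + n], since [X^e] has size [e + 1]. A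
    single [x] carries both components, so the coefficients of its normal form can be tested on the
    polynomial side. *)
Lemma weighted_sum_limit star r : F \is mpoly.symmetric -> mpoly.msize F = r.+1 ->
  exists x : zring R, [/\ zwt (r + n) x, (size x.2 <= n.+1)%N &
    forall k, x.1 k = \sum_(a : {ffun 'I_n -> 'I_k.+1} | is_composition a)
      ratr (mpoly.meval (fun j => (a j)%:R) F) * mz star (fun j => (2 * a j)%N)].
Proof.
move=> Fsym sF.
have [x Hx] := boolp.choice (fun m => msum_limit R star n (mono_polys m)).
exists (zscal R (n`!%:R^-1) * \sum_(m <- mpoly.msupp F) zscal R (mpoly.mcoeff m F) * x m); split.
- apply: wt_scale; rewrite big_seq_cond; apply: wt_sum => m; rewrite andbT => mF.
  apply: wt_scale; have [wx _ _] := Hx m; apply: wt_le wx.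
  rewrite (eq_bigr (fun i => (m i + 1)%N)); last first.
    by move=> i _; rewrite /mono_polys valK size_polyXn addn1.
  rewrite big_split /= sum1_card card_ord leq_add2r -mpoly.mdegE -ltnS -sF.
  exact: mpoly.msize_mdeg_lt.
- rewrite /= mul_polyC; apply: leq_trans (size_scale_leq _ _) _; rewrite zring_snd_sum.
  apply: leq_trans (size_sum _ _ _) _; apply/bigmax_leqP_seq => m _ _ /=.
  rewrite mul_polyC; apply: leq_trans (size_scale_leq _ _) _.
  by have [_ sx _] := Hx m.
move=> k.
have c1 : (\sum_(a : {ffun 'I_n -> 'I_k.+1} | is_composition a)
      ratr (mpoly.meval (fun j => (a j)%:R) F) * mztrunc R star N (fun j => (2 * a j)%N))
    @[N --> \oo] --> \sum_(a : {ffun 'I_n -> 'I_k.+1} | is_composition a)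
      ratr (mpoly.meval (fun j => (a j)%:R) F) * mz star (fun j => (2 * a j)%N).
  apply: cvg_sumr => a /andP[/forallP a1 _]; apply: cvgMl_tmp; apply: mztrunc_cvg => i.
  by have := a1 i; lia.
have c2 : (n`!%:R^-1 * \sum_(m <- mpoly.msupp F) ratr (mpoly.mcoeff m F) *
     msum R star n N (mono_polys m) k) @[N --> \oo] -->
   (zscal R (n`!%:R^-1) * \sum_(m <- mpoly.msupp F) zscal R (mpoly.mcoeff m F) * x m).1 k.
  rewrite /= ps_constM zring_fst_sum ps_sumE fmorphV rmorph_nat.
  apply: cvgMl_tmp; apply: cvg_sumr => m _; rewrite [X in _ --> X]ps_constM.
  by apply: cvgMl_tmp; have [_ _ cx] := Hx m; exact: cx.
have E : (fun N => \sum_(a : {ffun 'I_n -> 'I_k.+1} | is_composition a)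
      ratr (mpoly.meval (fun j => (a j)%:R) F) * mztrunc R star N (fun j => (2 * a j)%N)) =
   (fun N => n`!%:R^-1 * \sum_(m <- mpoly.msupp F) ratr (mpoly.mcoeff m F) *
     msum R star n N (mono_polys m) k).
  apply/funext => N; rewrite /mztrunc.
  transitivity (\sum_(t : n.-tuple 'I_N | mz_sorted star t) wterm k t).
    by rewrite exchange_big /=; apply: eq_bigr => a _; rewrite mulr_sumr.
  have nz : n`!%:R != 0 :> R by rewrite pnatr_eq0 -lt0n fact_gt0.
  apply: (mulfI nz); rewrite mulrA mulfV // mul1r.
  rewrite -symmetrize_sum; last by move=> s t; exact: wterm_perm.
  under eq_bigr => t _ do rewrite wtermE mulr_sumr.
  rewrite exchange_big /=; apply: eq_bigr => m _.
  rewrite /msum ps_sumE mulr_sumr; apply: eq_bigr => t _.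
  by rewrite ps_constM mulrCA.
rewrite E in c1; exact: cvg_unique c2 c1.
Qed.

End Weighted.

(** * The theorem *)

Section Final.
Variable R : realType.
Notation zwt := (wt (@zscal R) (@zt R) (@zW R)).

Lemma tau_zeven l : exists rho : rat, tau R ^+ l = ratr rho * zeven R l.
Proof.
have [c c0 ->] := zeven_tau R l; exists c^-1.
by rewrite mulrA -rmorphM mulVf // rmorph1 mul1r.
Qed.

Lemma zt_fstX l : (zt R ^+ l).1 = ps_mono (tau R ^+ l) l.
Proof. by rewrite zring_fstX ps_monoX. Qed.

Lemma zt_sndX l : (zt R ^+ l).2 = (-1) ^+ l *: 'X^(2 * l).
Proof. by rewrite zring_sndX /= -scaleN1r exprZn exprM. Qed.

(** On the polynomial side [t^l delta^j W] is [(-1)^l 2^-j s^(2l+1)] and [t^l] is [(-1)^l s^(2l)],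
    so parity separates [a] from [b]. *)
Lemma normal_form_snd w (a : nat -> nat -> rat) (b : nat -> rat) (x : zring R) :
  x = \sum_(l < w.+1) \sum_(j < w) zscal R (a l j) * (zt R ^+ l * iter j (@zder R) (zW R))
      + \sum_(l < w.+1) zscal R (b l) * zt R ^+ l ->
  x.2 = \sum_(l < w.+1) (-1) ^+ l *: ((\sum_(j < w) a l j * 2^-1 ^+ j) *: 'X^((2 * l).+1)
         + b l *: 'X^(2 * l)).
Proof.
move=> ->; rewrite /= !zring_snd_sum -big_split; apply: eq_bigr => l _ /=.
rewrite zring_snd_sum scalerDr; congr (_ + _); last first.
  by rewrite mul_polyC zt_sndX !scalerA mulrC.
rewrite scaler_suml scaler_sumr; apply: eq_bigr => j _ /=.
rewrite zt_sndX iter_zder_snd mul_polyC -scalerAl -scalerAr -exprSr !scalerA.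
by congr (_ *: _); ring.
Qed.

Lemma normal_form_coef_even w (a : nat -> nat -> rat) (b : nat -> rat) (x : zring R) l : (l <= w)%N ->
  x.2 = \sum_(l < w.+1) (-1) ^+ l *: ((\sum_(j < w) a l j * 2^-1 ^+ j) *: 'X^((2 * l).+1)
         + b l *: 'X^(2 * l)) ->
  (x.2)`_(2 * l) = (-1) ^+ l * b l.
Proof.
move=> lw ->; rewrite coef_sum -ltnS in lw *.
rewrite (bigD1 (Ordinal lw)) //= [X in _ + X]big1 ?addr0 => [|i].
  have e1 : (2 * l == (2 * l).+1)%N = false by lia.
  by rewrite coefZ coefD !coefZ !coefXn eqxx e1 mulr0 add0r mulr1.
rewrite -val_eqE /= => il.
have e1 : (2 * l == (2 * i).+1)%N = false by lia.
have e2 : (2 * l == 2 * i)%N = false by lia.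
by rewrite coefZ coefD !coefZ !coefXn e1 e2 !mulr0 ?addr0 ?mulr0.
Qed.

Lemma normal_form_coef_odd w (a : nat -> nat -> rat) (b : nat -> rat) (x : zring R) l : (l <= w)%N ->
  x.2 = \sum_(l < w.+1) (-1) ^+ l *: ((\sum_(j < w) a l j * 2^-1 ^+ j) *: 'X^((2 * l).+1)
         + b l *: 'X^(2 * l)) ->
  (x.2)`_((2 * l).+1) = (-1) ^+ l * \sum_(j < w) a l j * 2^-1 ^+ j.
Proof.
move=> lw ->; rewrite coef_sum -ltnS in lw *.
rewrite (bigD1 (Ordinal lw)) //= [X in _ + X]big1 ?addr0 => [|i].
  have e1 : ((2 * l).+1 == 2 * l)%N = false by lia.
  by rewrite coefZ coefD !coefZ !coefXn eqxx e1 mulr0 addr0 mulr1.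
rewrite -val_eqE /= => il.
have e1 : ((2 * l).+1 == 2 * i)%N = false by lia.
have e2 : ((2 * l).+1 == (2 * i).+1)%N = false by lia.
by rewrite coefZ coefD !coefZ !coefXn e1 e2 !mulr0 ?addr0 ?mulr0.
Qed.

Lemma normal_form_fst w (a : nat -> nat -> rat) (b : nat -> rat) (x : zring R) k :
  x = \sum_(l < w.+1) \sum_(j < w) zscal R (a l j) * (zt R ^+ l * iter j (@zder R) (zW R))
      + \sum_(l < w.+1) zscal R (b l) * zt R ^+ l ->
  x.1 k = \sum_(l < w.+1 | (l <= k)%N)
      (\sum_(j < w) ratr (a l j) * (k - l)%:R ^+ j) * (tau R ^+ l * zeven R (k - l))
    + (if (k <= w)%N then ratr (b k) * tau R ^+ k else 0).
Proof.
move=> ->; rewrite /= ps_addE !zring_fst_sum !ps_sumE; congr (_ + _).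
  rewrite [RHS]big_mkcond; apply: eq_bigr => l _.
  rewrite zring_fst_sum ps_sumE mulr_suml.
  have E j : (zscal R (a l j) * (zt R ^+ l * iter j (@zder R) (zW R))).1 k =
     if (l <= k)%N then ratr (a l j) * (k - l)%:R ^+ j * (tau R ^+ l * zeven R (k - l)) else 0.
    rewrite /= ps_constM zt_fstX ps_monoM iter_zder_fst.
    by case: ifP => _; rewrite ?mulr0 //; ring.
  rewrite (eq_bigr _ (fun (j : 'I_w) _ => E j)); case: ifP => // _.
  by rewrite big1.
have E l : (zscal R (b l) * zt R ^+ l).1 k = if k == l then ratr (b l) * tau R ^+ l else 0.
  rewrite /= ps_constM zt_fstX /ps_mono.
  by case: ifP; rewrite ?mulr0.
rewrite (eq_bigr _ (fun (l : 'I_w.+1) _ => E l)); case: leqP => kw.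
  rewrite -ltnS in kw; rewrite (bigD1 (Ordinal kw)) //= eqxx big1 ?addr0 // => i.
  by rewrite -val_eqE /= eq_sym => /negbTE ->.
by rewrite big1 // => i _; rewrite gtn_eqF //; have := ltn_ord i; lia.
Qed.

Lemma weighted_sum_formula star n r (F : mpoly.mpoly n rat) :
  (0 < n)%N -> F \is mpoly.symmetric -> mpoly.msize F = r.+1 ->
  exists c : nat -> {poly rat},
    (forall l : nat, (l <= bound_T n r)%N -> (size (c l) <= r + n - 2 * l)%N) /\
    (forall k : nat, (n <= k)%N ->
       \sum_(a : {ffun 'I_n -> 'I_k.+1} | is_composition a)
          ratr (mpoly.meval (fun j => (a j)%:R) F) * mz R star (fun j => (2 * a j)%N)
       = \sum_(0 <= l < (minn (bound_T n r) k).+1)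
          ratr (c l).[k%:R] * zeta R (2 * l) * zeta R (2 * k - 2 * l)).
Proof.
move=> n0 Fsym sF.
have [x [wx sx Hx]] := weighted_sum_limit R star Fsym sF.
have [a [b [a0 b0 xE]]] := nf_coef
  (wt_nf (@zderD R) (@zderM R) (@zder_scal R) (zder_zt R) (zder_zW R) wx).
have [rho Hrho] := boolp.choice tau_zeven.
have x2 := normal_form_snd xE.
have sgn l : (-1) ^+ l != 0 :> rat by rewrite expf_neq0 // oppr_eq0 oner_neq0.
(* Up to sign [b k] is the coefficient of [s^(2k)]; the degree is at most [n], and [2k > n] since
   [k >= n >= 1]. *)
have b0' k : (n <= k)%N -> b k = 0.
  move=> nk; have [kw|/b0 //] := leqP (2 * k) (r + n).
  have kw' : (k <= r + n)%N by lia.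
  have := normal_form_coef_even kw' x2; rewrite nth_default; last first.
    by apply: leq_trans sx _; lia.
  by move/esym/eqP; rewrite mulf_eq0 (negbTE (sgn _)) /= => /eqP.
(* Beyond [T] the weight leaves only [2l + 1 = r + n] and [j = 0], and then [r > 0]. Up to sign the
   coefficient of [s^(2l+1)] is this single [a l 0], and it vanishes because [r + n > n]. *)
have aT l j : (bound_T n r < l)%N -> a l j = 0.
  rewrite /bound_T => Tl; have [/a0 //|wl] := leqP (r + n) (2 * l + j).
  have [Hl j0 nw] : [/\ (2 * l).+1 = (r + n)%N, j = 0%N & (n < r + n)%N].
    move: Tl; rewrite gtn_max => /andP[T1 T2]; split; lia.
  have lw : (l <= r + n)%N by lia.
  have := normal_form_coef_odd lw x2; rewrite nth_default; last by apply: leq_trans sx _; lia.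
  move/esym/eqP; rewrite mulf_eq0 (negbTE (sgn _)) /=.
  have w0 : (0 < r + n)%N by lia.
  rewrite (bigD1 (Ordinal w0)) //= big1 => [|i].
    by rewrite addr0 mulr1 j0 => /eqP.
  by rewrite -val_eqE /= => i0; rewrite a0 ?mul0r //; lia.
(* [rho l] converts [tau^l] into [zeta(2l)], and [X - l] reflects the factor [(k-l)^j] that
   [t^l delta^j W] has at [u^k]. Cutting [j] at [r + n - 2l] drops only zero coefficients and yields
   the degree bound. *)
exists (fun l => rho l *: \sum_(j < r + n - 2 * l) a l j *: ('X - l%:R%:P) ^+ j); split.
  move=> l lT; apply: leq_trans (size_scale_leq _ _) _.
  apply: leq_trans (size_sum _ _ _) _; apply/bigmax_leqP => j _.
  by apply: leq_trans (size_scale_leq _ _) _; rewrite size_exp_XsubC.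
move=> k nk; rewrite -Hx (normal_form_fst k xE) b0' // rmorph0 mul0r if_same addr0.
rewrite big_mkord.
rewrite [RHS](eq_bigr (fun l : 'I_(minn (bound_T n r) k).+1 =>
   (\sum_(j < r + n) ratr (a l j) * (k - l)%:R ^+ j) * (tau R ^+ l * zeven R (k - l)))); last first.
  move=> l _; have := ltn_ord l; rewrite ltnS leq_min => /andP[lT lk].
  rewrite -mulnBr -/(zeven R l) -/(zeven R (k - l)) /= hornerZ rmorphM Hrho /=.
  rewrite (_ : ratr _.[_] = \sum_(j < r + n) ratr (a l j) * (k - l)%:R ^+ j); first by ring.
  rewrite horner_sum rmorph_sum (big_ord_widen (r + n) (fun j =>
     ratr (a l j *: ('X - l%:R%:P) ^+ j).[k%:R])) ?leq_subr //= big_mkcond.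
  apply: eq_bigr => j _; case: ltnP => jl.
    rewrite hornerZ horner_exp hornerXsubC rmorphM rmorphXn rmorphB !rmorph_nat.
    by rewrite natrB.
  by rewrite a0 ?rmorph0 ?mul0r //; move: jl; lia.
(* The right-hand range is widened to [l <= r + n]; on the left the terms beyond [T] vanish by
   [aT]. *)
rewrite (big_ord_widen_cond (r + n).+1 predT (fun l =>
  (\sum_(j < r + n) ratr (a l j) * (k - l)%:R ^+ j) * (tau R ^+ l * zeven R (k - l)))); last first.
  by rewrite /bound_T; lia.
rewrite big_mkcond [RHS]big_mkcond; apply: eq_bigr => l _ /=.
rewrite ltnS leq_min andbC; case: leqP => //= lk; case: leqP => // Tl.
by rewrite big1 ?mul0r // => j _; rewrite aT // rmorph0 mul0r.
Qed.

End Final.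

Theorem theorem4p3 (R : realType) (n r : nat) (F : mpoly.mpoly n rat) :
  (0 < n)%N ->
  F \is mpoly.symmetric ->
  mpoly.msize F = r.+1 ->
  exists c cstar : nat -> {poly rat},
    (forall l : nat, (l <= bound_T n r)%N ->
       (size (c l) <= r + n - 2 * l)%N /\
       (size (cstar l) <= r + n - 2 * l)%N) /\
    (forall k : nat, (n <= k)%N ->
       \sum_(a : {ffun 'I_n -> 'I_k.+1} | is_composition a)
          ratr (mpoly.meval (fun j => (a j)%:R) F)
            * mzv R (fun j => (2 * a j)%N)
       = \sum_(0 <= l < (minn (bound_T n r) k).+1)
          ratr (c l).[k%:R] * zeta R (2 * l) * zeta R (2 * k - 2 * l)
       /\
       \sum_(a : {ffun 'I_n -> 'I_k.+1} | is_composition a)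
          ratr (mpoly.meval (fun j => (a j)%:R) F)
            * mzsv R (fun j => (2 * a j)%N)
       = \sum_(0 <= l < (minn (bound_T n r) k).+1)
          ratr (cstar l).[k%:R] * zeta R (2 * l) * zeta R (2 * k - 2 * l)).
Proof.
move=> n0 Fsym sF.
have [c [sc Hc]] := weighted_sum_formula R false n0 Fsym sF.
have [c' [sc' Hc']] := weighted_sum_formula R true n0 Fsym sF.
exists c, c'; split=> [l lT|k nk]; first by split; [exact: sc|exact: sc'].
by split; [exact: Hc|exact: Hc'].
Qed.
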